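(* Let $e \in \{4, 5, \ldots, 130\}$ and let $n \ge b_e$ be an integer. Suppose that $G$ attains the maximum spectral radius on $\mathcal{C}_{n,e}$. Then $G \cong \mathcal{D}_{n,e}$, or ($n \ge e+2$ and $G \cong \mathcal{V}_{n,e}$).
   Context: All graphs are undirected, finite and simple. The spectral radius $\rho(G)$ of a graph $G$ is the largest modulus of an eigenvalue of its adjacency matrix. $G_1 \lor G_2$ and $G_1 + G_2$ denote the join and the disjoint union of graphs; $K_0$ (and $0K_1$) is the empty graph on no vertices, which is neutral for both operations. $\mathcal{C}_{n,e}$ is the set of connected graphs with $n$ vertices and $n-1+e$ edges. For an integer $e \ge 1$, let $k_e$ be the largest natural number with $\binom{k_e}{2} \le e$, and let $t_e = e - \binom{k_e}{2}$ (so $0 \le t_e \le k_e - 1$). Let $b_e = k_e + 1$ if $t_e = 0$, and $b_e = k_e + 2$ if $t_e \ne 0$; a graph in $\mathcal{C}_{n,e}$ exists if and only if $n \ge b_e$. For $n \ge b_e$, the graph $\mathcal{D}_{n,e} \in \mathcal{C}_{n,e}$ is $$\mathcal{D}_{n,e} = \big( ( (K_{k_e - t_e} + K_1) \lor K_{t_e} ) + (n - k_e - 2) K_1 \big) \lor K_1 \quad \text{if } n \ge k_e + 2, \qquad \mathcal{D}_{n,e} = K_n \quad \text{if } n < k_e + 2.$$ For $n \ge e+2$, the graph $\mathcal{V}_{n,e} \in \mathcal{C}_{n,e}$ is $\mathcal{V}_{n,e} = (K_{1,e} + (n-e-2)K_1) \lor K_1$. *)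

(* Defs.v *)
From mathcomp Require Import all_boot all_order all_algebra.
From mathcomp Require Import complex.
From mathcomp Require Import zify.
From mathcomp Require Import classical_sets boolp reals.

Set Implicit Arguments.
Unset Strict Implicit.
Unset Printing Implicit Defensive.

Import Order.TTheory GRing.Theory Num.Theory.
Local Open Scope nat_scope.

Record sgraph := SGraph {
  vertex :> finType;
  adj : rel vertex;
  adj_sym : symmetric adj;
  adj_irr : irreflexive adj }.

Definition giso (G H : sgraph) : Prop :=
  exists f : G -> H, bijective f /\ forall x y, adj (f x) (f y) = adj x y.

Definition complete_rel n : rel 'I_n := fun x y => x != y.
Lemma complete_sym n : symmetric (@complete_rel n).
Proof. by move=> x y; rewrite /complete_rel eq_sym. Qed.
Lemma complete_irr n : irreflexive (@complete_rel n).
Proof. by move=> x; rewrite /complete_rel eqxx. Qed.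
Definition complete n : sgraph := SGraph (@complete_sym n) (@complete_irr n).

Definition edgeless_rel n : rel 'I_n := fun _ _ => false.
Lemma edgeless_sym n : symmetric (@edgeless_rel n). Proof. by []. Qed.
Lemma edgeless_irr n : irreflexive (@edgeless_rel n). Proof. by []. Qed.
Definition edgeless n : sgraph := SGraph (@edgeless_sym n) (@edgeless_irr n).

(* The disjoint union is [b = false] and the join is [b = true]. *)
Section SumGraph.
Variables (b : bool) (G H : sgraph).
Definition sum_rel : rel (G + H)%type := fun u v =>
  match u, v with
  | inl x, inl y => adj x y
  | inr x, inr y => adj x y
  | _, _ => b
  end.
Lemma sum_sym : symmetric sum_rel.
Proof. by case=> x [] y //=; rewrite adj_sym. Qed.
Lemma sum_irr : irreflexive sum_rel.
Proof. by case=> x /=; rewrite adj_irr. Qed.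
Definition sum_graph : sgraph := SGraph sum_sym sum_irr.
End SumGraph.

Definition gunion := sum_graph false.
Definition gjoin := sum_graph true.

Definition complete_bipartite m n : sgraph := gjoin (edgeless m) (edgeless n).

Definition edges (G : sgraph) : {set {set G}} :=
  [set [set p.1; p.2] | p : G * G & adj p.1 p.2].

Definition connected_graph (G : sgraph) : Prop :=
  0 < #|G| /\ forall x y : G, connect (@adj G) x y.

Definition in_C (n e : nat) (G : sgraph) : Prop :=
  [/\ #|G| = n, connected_graph G & #|edges G| = n - 1 + e].

Definition adj_mx (K : pzRingType) (G : sgraph) : 'M[K]_#|G| :=
  \matrix_(i, j) (adj (enum_val i) (enum_val j))%:R%R.

(* The set is finite, and nonempty when [G] has a vertex, so its supremum is
   its largest element: see [spectral_radiusP]. *)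
Definition spectral_radius (R : realType) (G : sgraph) : R :=
  sup [set Normc.normc z | z in [set z : R[i] | eigenvalue (adj_mx R[i] G) z]]%classic.

Lemma spectral_radiusP (R : realType) (G : sgraph) : 0 < #|G| ->
  (exists2 z : R[i], eigenvalue (adj_mx R[i] G) z &
     spectral_radius R G = Normc.normc z) /\
  (forall z : R[i], eigenvalue (adj_mx R[i] G) z ->
     (Normc.normc z <= spectral_radius R G)%R).
Proof.
move=> G0; rewrite /spectral_radius; set A := adj_mx _ G.
have [r rE] := closed_field_poly_normal (char_poly A).
have memr z : eigenvalue A z = (z \in r).
  rewrite eigenvalue_root_char rE (monicP (char_poly_monic A)) scale1r.
  by rewrite root_prod_XsubC.
have r0 : 0 < size r.
  rewrite lt0n size_eq0; apply/eqP => r0; have := size_char_poly A.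
  rewrite rE r0 big_nil (monicP (char_poly_monic A)) scale1r size_poly1.
  by case: #|G| G0.
pose i := [arg max_(i > Ordinal r0) Normc.normc (r`_i)%R]%O.
have maxr z : z \in r -> (Normc.normc z <= Normc.normc (r`_i)%R)%R.
  move=> zr; rewrite /i; case: Order.TotalTheory.arg_maxP => // j _ jmax.
  have zi : index z r < size r by rewrite index_mem.
  by have := jmax (Ordinal zi) isT; rewrite /= nth_index.
have ir : (r`_i)%R \in r by rewrite mem_nth.
suff -> : sup [set Normc.normc z | z in [set z : R[i] | eigenvalue A z]]%classic
    = Normc.normc (r`_i)%R.
  by split=> [|z]; [exists (r`_i)%R => //; rewrite memr | rewrite memr => /maxr].
have ubA : ubound [set Normc.normc z | z in [set z : R[i] | eigenvalue A z]]%classic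
    (Normc.normc (r`_i)%R) by move=> _ [z /= + <-]; rewrite memr => /maxr.
apply/le_anti/andP; split.
  apply: ge_sup => //; exists (Normc.normc (r`_i)%R), (r`_i)%R => //=.
  by rewrite memr.
apply: ub_le_sup; first by exists (Normc.normc (r`_i)%R).
by exists (r`_i)%R => //=; rewrite memr.
Qed.

Definition maximises_spectral_radius (R : realType) (n e : nat) (G : sgraph) : Prop :=
  in_C n e G /\
  forall H, in_C n e H -> (spectral_radius R H <= spectral_radius R G)%R.

(* Since 'C(e + 2, 2) > e, the bound on [k] loses nothing: see [k_P]. *)
Definition k_ (e : nat) : nat := \max_(k < e.+2 | 'C(k, 2) <= e) k.

Lemma k_P e : 'C(k_ e, 2) <= e /\ forall k, 'C(k, 2) <= e -> k <= k_ e.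
Proof.
split.
  by rewrite /k_; elim/big_ind: _ => // x y hx hy; rewrite /maxn; case: ifP.
move=> k hk; have lt_k : k < e.+2.
  rewrite ltnNge; apply/negP => hek.
  have := leq_trans (leq_bin2l 2 hek) hk.
  by rewrite binS bin1; lia.
by rewrite /k_ (bigD1 (Ordinal lt_k)) //= leq_maxl.
Qed.

Definition t_ (e : nat) : nat := e - 'C(k_ e, 2).

Definition b_ (e : nat) : nat := if t_ e == 0 then k_ e + 1 else k_ e + 2.

Definition D_graph (n e : nat) : sgraph :=
  let k := k_ e in let t := t_ e in
  if k + 2 <= n then
    gjoin
      (gunion (gjoin (gunion (complete (k - t)) (complete 1)) (complete t))
              (edgeless (n - k - 2)))
      (complete 1)
  else complete n.

Definition V_graph (n e : nat) : sgraph :=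
  gjoin (gunion (complete_bipartite 1 e) (edgeless (n - e - 2))) (complete 1).

(* Main.v *)
(* A maximiser has a Perron vector x.  Rotating an edge vw to uw with x_u >= x_v
   increases the spectral radius, so the vertex with the largest entry is joined to
   all others and the rest is a threshold graph, encoded by a strict partition q of e:
   in the order of decreasing x, vertex i is joined to the next q_i vertices.  Eliminating
   the vertices one by one turns the eigenvalue equation into l^2 = n - 1 + psi l q,
   with psi a continued fraction, and the spectral radius is compared with l by
   testing the inequality on explicit vectors.  So it suffices to maximise psi l q over q, for all
   l >= k; D and V correspond to (k, k-1, ..) with t parts kept and the others lowered
   by one, and to (e).  A Chebyshev-type inequality shows that l - 2e / psi l q is
   nondecreasing in l.  Therefore one table at a point l* shows that D wins on [k, l*], and
   finitely many further tables show that the star wins beyond l*; these tables are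
   computed by dynamic programming in integer arithmetic. *)
From Stdlib Require Import ZArith.
Require Import Defs.
From mathcomp Require Import all_boot all_order all_algebra.
From mathcomp Require Import complex spectral sesquilinear reals.
From mathcomp Require Import ssrZ zify ring lra.
Set Implicit Arguments.
Unset Strict Implicit.
Unset Printing Implicit Defensive.
Import Order.TTheory GRing.Theory Num.Theory.
Local Open Scope ring_scope.

(** * The continued fraction of a strict partition *)

(** Expanded at infinity, [psi l p] is the sum over i >= 1 of w_i / l^i, where w_i counts the walks
    with i edges and w_1 = 2 e. The leading term is thus the same for all partitions of e, and l is
    unbounded because n is, so a table at one point says nothing by itself about other values of l.
    The quantity l - 2 e / psi bridges this gap: it increases with psi at fixed l and is
    nondecreasing in l, so its values for D at k and for a competitor at l* settle every l in
    between. The inequality behind it says that, in a threshold graph, the entries at the two ends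
    of an edge are negatively correlated. On [k, l*], D is compared only with partitions other than
    the star, since the theorem allows both outcomes; beyond l* the star has to beat D too. The
    range l >= k comes from the clique on k + 1 vertices in D. *)

Fixpoint strict (p : seq nat) : bool :=
  if p is d :: q then (head 0 q < d)%N && strict q else true.

Lemma strict_sum p : strict p -> (2 * sumn p <= head 0 p * (head 0 p).+1)%N.
Proof. by elim: p => //= d q IH /andP[hd /IH]; nia. Qed.

Lemma strict_tail_sum d q : strict (d :: q) -> (2 * sumn q + d <= d * d)%N.
Proof. by case/andP=> hd /strict_sum; nia. Qed.

Section Psi.
Variable R : realFieldType.
Implicit Types (l : R) (p q : seq nat).

(* If l x = c + A x on N vertices, A being the adjacency matrix of the threshold graph of
   [p], then l * (sum of x) = c * (N + psi l p): see [solves_psi].  The recursion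
   eliminates the dominating vertex. *)
Fixpoint psi l p : R :=
  if p is d :: q then
    let t := l + d%:R + psi l q in
    l * (l + 1) * t / (l * (l + 1) - t) - l - d.+1%:R
  else 0.

(* The denominators of [psi] are positive, that is, l exceeds the spectral radius of the graph of [p]. *)
Fixpoint good l p : bool :=
  if p is d :: q then (l + d%:R + psi l q < l * (l + 1)) && good l q else true.

(** Let y be l times the solution of l x = 1 + A x and v = head + 1, the number of non-isolated
    vertices if [p] is nonempty. Then y sums to v + psi over v vertices, and l psi is the sum of
    degree times y. The second bound says that the plain mean of y is at most its degree-weighted
    mean; the third, that the latter is at most the entry of a further dominating vertex, up to a
    common factor. *)
Definition psi_bounds l p : Prop :=
  [/\ 0 <= psi l p,
      2 * (sumn p)%:R * ((head 0%N p).+1%:R + psi l p) <= (head 0%N p).+1%:R * (l * psi l p)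
    & l * (l + 1) * psi l p <= 2 * (sumn p)%:R * (l + (head 0%N p).+1%:R + psi l p)].

Lemma psi_bounds_tail l d q : 0 < l -> strict (d :: q) -> psi_bounds l q ->
  let s := (sumn q)%:R in let S := d%:R + psi l q in let t0 := (l + S) / (l + 1) in
  [/\ S <= d%:R * t0, l * psi l q <= 2 * s * t0, 2 * s * S <= d%:R * (l * psi l q) & 0 < S].
Proof.
move=> l0 /andP[hd sq] [p0 hA hB] s S t0.
set v : R := (head 0%N q).+1%:R in hA hB.
have s0 : 0 <= s by rewrite ler0n.
have v1 : 1 <= v by rewrite ler1n.
have vd : v <= d%:R by rewrite ler_nat.
have l1 : 0 < l + 1 by lra.
have t0E : (l + 1) * t0 = l + S by rewrite /t0; field; lra.
rewrite -/s in hA hB.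
have h2s : 2 * s <= l * psi l q.
  have : v * (2 * s) <= v * (l * psi l q) by nra.
  by rewrite ler_pM2l //; lra.
have h3 : 2 * s * S <= d%:R * (l * psi l q).
  rewrite /S; have := mulr_ge0 (_ : 0 <= d%:R - v) (_ : 0 <= l * psi l q - 2 * s).
  by rewrite !subr_ge0 => /(_ vd h2s); lra.
have h2 : l * psi l q <= 2 * s * t0.
  rewrite -(ler_pM2l l1); have -> : (l + 1) * (2 * s * t0) = 2 * s * (l + S) by rewrite -t0E; ring.
  have : 2 * s * v <= 2 * s * d%:R by rewrite ler_wpM2l //; lra.
  by rewrite /S; lra.
have S0 : 0 < S by rewrite /S; lra.
split=> //.
case: (eqVneq s 0) => [s00|sn0].
  have p00 : psi l q = 0.
    move: hB; rewrite s00 mulr0 mul0r => hB; apply/le_anti; rewrite p0 andbT.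
    by move: hB; rewrite pmulr_rle0 // mulr_gt0.
  rewrite -(ler_pM2l l1) mulrCA t0E /S p00 addr0.
  have d1 : 1 <= d%:R :> R by lra.
  by nra.
have sp : 0 < 2 * s by rewrite mulr_gt0 // lt_neqAle eq_sym sn0.
rewrite -(ler_pM2l sp).
have d0 : 0 <= d%:R :> R by [].
have := ler_wpM2l d0 h2; lra.
Qed.

(** If x0 is the solution's entry at the new dominating vertex, then [g] = 1 + x0 is the factor by
    which the solution on the tail is multiplied, and [g * t0] = l x0. The third identity is the
    degree-weighted sum: vertex 0 has degree d, each of its d neighbours gains one, and the tail
    contributes [l * psi l q]. *)
Lemma psi_cons l d q : 0 < l -> l + d%:R + psi l q < l * (l + 1) ->
  let S := d%:R + psi l q in let t0 := (l + S) / (l + 1) in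
  let g := l * (l + 1) / (l * l - S) in
  [/\ 0 < g, psi l (d :: q) + d.+1%:R = g * (t0 + S),
     l * psi l (d :: q) = g * (d%:R * t0 + S + l * psi l q)
   & l + d.+1%:R + psi l (d :: q) = g * (l + 1) * t0].
Proof.
move=> l0 h S t0 g.
have D0 : 0 < l * l - S by rewrite /S; lra.
have Dn : l * l - S != 0 by lra.
have l1 : l + 1 != 0 by lra.
have DE : l * (l + 1) - (l + d%:R + psi l q) = l * l - S by rewrite /S; ring.
have SE : psi l q = S - d%:R by rewrite /S; ring.
rewrite /= DE -[d.+1]addn1 natrD SE /t0 /g; split.
- by rewrite divr_gt0 // mulr_gt0 //; lra.
- by field; rewrite Dn l1.
- by field; rewrite Dn l1.
- by field; rewrite Dn l1.
Qed.

Lemma good_psi_bounds l p : 0 < l -> strict p -> good l p -> psi_bounds l p.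
Proof.
move=> l0; elim: p => [|d q IH].
  by move=> _ _; split; rewrite /= ?mulr0 ?mul0r.
move=> st gd; have iq : psi_bounds l q by apply: IH; [case/andP: st | case/andP: gd].
have [h1 h2 h3 S0] := psi_bounds_tail l0 st iq.
have hg : l + d%:R + psi l q < l * (l + 1) by case/andP: gd.
have [g0 e1 e2 e3] := psi_cons l0 hg.
have [p0 _ _] := iq.
move: h1 h2 h3 S0 g0 e1 e2 e3.
set S := d%:R + psi l q; set t0 := (l + S) / (l + 1); set g := _ / _.
move=> h1 h2 h3 S0 g0 e1 e2 e3.
set s : R := (sumn q)%:R in h2 h3.
have s2 : 2 * s <= d%:R * d%:R - d%:R.
  by have := strict_tail_sum st; rewrite -(ler_nat R) natrD !natrM /s; lra.
have d1 : 1 <= d%:R :> R by case/andP: st => hd _; rewrite ler1n (leq_ltn_trans _ hd).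
have s0 : 0 <= s by rewrite ler0n.
have t00 : 0 < t0 by rewrite divr_gt0 //; lra.
have a0 : 0 <= l * psi l q by rewrite mulr_ge0 // ltW.
have lp : 0 <= l * psi l (d :: q) by rewrite e2 mulr_ge0 ?(ltW g0) //; nra.
have sumE : (sumn (d :: q))%:R = d%:R + s by rewrite /= natrD.
split.
- by rewrite -(pmulr_rge0 _ l0).
- rewrite sumE -[head _ _]/d [_ + psi _ _]addrC e1 e2 -[d.+1]addn1 natrD.
  rewrite mulrCA [leRHS]mulrCA ler_pM2l // -(ler_pM2l (_ : 0 < d%:R)); last lra.
  have : 0 <= (d%:R * t0 - S) * (d%:R * d%:R - d%:R - 2 * s) by apply: mulr_ge0; lra.
  have : 0 <= (d%:R + 1) * (d%:R * (l * psi l q) - 2 * s * S) by apply: mulr_ge0; lra.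
  by lra.
- rewrite -[head _ _]/d sumE e3.
  have -> : l * (l + 1) * psi l (d :: q) = (l + 1) * (l * psi l (d :: q)) by ring.
  have -> : 2 * (d%:R + s) * (g * (l + 1) * t0) = (l + 1) * (g * (2 * (d%:R + s) * t0)) by ring.
  by rewrite e2 !ler_pM2l //; lra.
Qed.

(* With m = d mu, m' = d mu', a = 2 s nu, a' = 2 s nu' and b <= 2 s nu nu', the
   difference of the two sides is at least d^2 (t - mu)(t' - mu')
   + 2 s d ((t - nu)(nu' - mu') + (nu - mu)(t' - nu')). *)
Lemma bilinear_mean_le (d s t m a t' m' a' b : R) : 0 < d -> 0 <= s ->
  m <= d * t -> a <= 2 * s * t -> 2 * s * m <= d * a ->
  m' <= d * t' -> a' <= 2 * s * t' -> 2 * s * m' <= d * a' ->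
  2 * s * b <= a * a' -> (s = 0 -> b = 0 /\ a = 0 /\ a' = 0) ->
  2 * (d + s) * (b + t * m' + t' * m) <= (d * t + m + a) * (d * t' + m' + a').
Proof.
move=> d0 s0 h1 h2 h3 h1' h2' h3' hb hs.
have [s00|sn0] := eqVneq s 0.
  have [-> [-> ->]] := hs s00; rewrite s00.
  have : 0 <= (d * t - m) * (d * t' - m') by apply: mulr_ge0; lra.
  lra.
have sp : 0 < s by rewrite lt_neqAle eq_sym sn0.
have [mu mE] : exists mu, m = d * mu by exists (m / d); rewrite mulrC divfK ?gt_eqF.
have [mu' mE'] : exists mu, m' = d * mu by exists (m' / d); rewrite mulrC divfK ?gt_eqF.
have [nu aE] : exists nu, a = 2 * s * nu by exists (a / (2 * s)); rewrite mulrC divfK ?gt_eqF //; lra.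
have [nu' aE'] : exists nu, a' = 2 * s * nu by exists (a' / (2 * s)); rewrite mulrC divfK ?gt_eqF //; lra.
have s2 : 0 < 2 * s by lra.
subst m m' a a'.
move: h1 h2 h1' h2'; rewrite !ler_pM2l // => h1 h2 h1' h2'.
have le3 (x y : R) : 2 * s * (d * x) <= d * (2 * s * y) -> x <= y.
  by rewrite [d * (_ * _)]mulrCA !ler_pM2l.
move: h3 h3' => /le3 h3 /le3 h3'.
have hb' : b <= 2 * s * nu * nu'.
  by rewrite -(ler_pM2l s2); apply: le_trans hb _; lra.
have p1 : 0 <= d * d * ((t - mu) * (t' - mu')).
  by apply: mulr_ge0; [nra|apply: mulr_ge0; lra].
have p2 : 0 <= s * d * ((t - nu) * (nu' - mu') + (nu - mu) * (t' - nu')).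
  by apply: mulr_ge0; [nra|apply: addr_ge0; apply: mulr_ge0; lra].
have p3 : 0 <= (d + s) * (2 * s * nu * nu' - b) by apply: mulr_ge0; lra.
lra.
Qed.

(** By the resolvent identity, [b] is the sum of y_i y'_j over ordered adjacent pairs, y and y'
    being l and l' times the respective solutions. The last bound compares the mean of y_i y'_j over
    the 2 s ordered edges with the product of the two means. A new dominating vertex adds the cross
    terms [t * S'] and [t' * S]. *)
Lemma psi_bilinear l l' p : 0 < l -> l <= l' -> strict p -> good l p ->
  [/\ good l' p, psi l' p <= psi l p &
   exists2 b, 0 <= b & l * l' * (psi l p - psi l' p) = (l' - l) * b /\
     2 * (sumn p)%:R * b <= (l * psi l p) * (l' * psi l' p)].
Proof.
move=> l0 ll'; have l0' : 0 < l' by lra.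
elim: p => [|d q IH].
  by move=> _ _; split=> //; exists 0 => //=; rewrite !mulr0 subrr !mulr0.
move=> st gd; have [hg gq] : l + d%:R + psi l q < l * (l + 1) /\ good l q by case/andP: gd.
have sq : strict q by case/andP: st.
have [gq' le_psi [b b0 [bE bM]]] := IH sq gq.
have hg' : l' + d%:R + psi l' q < l' * (l' + 1) by nra.
have [h1 h2 h3 S0] := psi_bounds_tail l0 st (good_psi_bounds l0 sq gq).
have [h1' h2' h3' S0'] := psi_bounds_tail l0' st (good_psi_bounds l0' sq gq').
have [g0 e1 e2 _] := psi_cons l0 hg.
have [g0' e1' e2' _] := psi_cons l0' hg'.
have gd' : good l' (d :: q) by rewrite /= hg'.
move: h1 h2 h3 S0 h1' h2' h3' S0' g0 e1 e2 g0' e1' e2'.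
set S := d%:R + psi l q; set t := (l + S) / (l + 1); set g := _ / (l * l - S).
set S' := d%:R + psi l' q; set t' := (l' + S') / (l' + 1); set g' := _ / (l' * l' - S').
move=> h1 h2 h3 S0 h1' h2' h3' S0' g0 e1 e2 g0' e1' e2'.
have d0 : 0 < d%:R :> R by case/andP: st => hd _; rewrite ltr0n (leq_ltn_trans _ hd).
have t0 : 0 < t by rewrite divr_gt0 //; lra.
have t0' : 0 < t' by rewrite divr_gt0 //; lra.
have [c c0 [cE cM]] : exists2 c, 0 <= c & l * l' * (psi l q - psi l' q) = (l' - l) * c /\
    2 * (d%:R + (sumn q)%:R) * (c + t * S' + t' * S) <=
    (d%:R * t + S + l * psi l q) * (d%:R * t' + S' + l' * psi l' q).
  (* For an edgeless tail the bound on [b] from the induction is void, so 0 is taken instead. *)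
  case: (eqVneq (sumn q) 0%N) => [s0|sn0].
    have qE : q = [::] by case: (q) sq s0 => //= a r /andP[] /(leq_ltn_trans (leq0n _)); case: a.
    exists 0 => //; rewrite qE /= !mulr0 subrr mulr0; split=> //.
    by apply: bilinear_mean_le => //; rewrite ?qE /= in h2 h3 h2' h3' *; rewrite ?mulr0 ?mul0r; lra.
  exists b => //; split=> //; apply: bilinear_mean_le => //.
  by move/eqP; rewrite pnatr_eq0 (negPf sn0).
set B := g * g' * (c + t * S' + t' * S).
have B0 : 0 <= B.
  apply: mulr_ge0; first by rewrite mulr_ge0 // ltW.
  by rewrite !addr_ge0 // mulr_ge0 // ltW.
have BE : l * l' * (psi l (d :: q) - psi l' (d :: q)) = (l' - l) * B.
  have -> : psi l (d :: q) - psi l' (d :: q) = g * (t + S) - g' * (t' + S') by rewrite -e1 -e1'; ring.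
  have -> : (l' - l) * B = g * g' * ((l' - l) * c + (l' - l) * (t * S' + t' * S)) by rewrite /B; ring.
  rewrite -cE; have -> : psi l q - psi l' q = S - S' by rewrite /S /S'; ring.
  have n1 : l * l - S != 0 by rewrite /S; lra.
  have n2 : l' * l' - S' != 0 by rewrite /S'; lra.
  rewrite /t /t' /g /g'; field; rewrite n1 n2 /=; lra.
split=> //.
  rewrite -subr_ge0 -(pmulr_rge0 _ (mulr_gt0 l0 l0')) BE mulr_ge0 //; lra.
exists B => //; split=> //.
rewrite e2 e2' /= natrD /B.
have -> x y : g * x * (g' * y) = g * g' * (x * y) by ring.
by rewrite mulrCA ler_pM2l // mulr_gt0.
Qed.

(* That is, l - 2 e / psi l p is nondecreasing in l. *)
Lemma psi_increment l l' p : 0 < l -> l <= l' -> strict p -> good l p ->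
  2 * (sumn p)%:R * (psi l p - psi l' p) <= (l' - l) * (psi l p * psi l' p).
Proof.
move=> l0 ll' st gd; have [_ _ [b b0 [bE bM]]] := psi_bilinear l0 ll' st gd.
have l0' : 0 < l * l' by rewrite mulr_gt0 //; lra.
rewrite -(ler_pM2l l0') mulrCA bE mulrCA.
have -> : l * l' * ((l' - l) * (psi l p * psi l' p)) = (l' - l) * (l * psi l p * (l' * psi l' p)) by ring.
by rewrite ler_wpM2l //; lra.
Qed.

(** In terms of walks: d is the largest degree, so w_(i+1) <= d w_i, and the series is at most the
    geometric one. This controls all large l without a table. *)
Lemma psi_head_le l d q : 0 < l -> strict (d :: q) -> good l (d :: q) ->
  psi l (d :: q) * (l - d%:R) <= 2 * (sumn (d :: q))%:R.
Proof.
move=> l0 st gd; have [p0 hA hB] := good_psi_bounds l0 st gd.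
move: p0 hA hB; rewrite -[head _ _]/d; set p := psi _ _; set s := (sumn _)%:R.
rewrite -[d.+1]addn1 natrD => p0 hA hB.
by rewrite -(ler_pM2l l0); lra.
Qed.
End Psi.

(** * The computation *)

Section Program.
Local Open Scope Z_scope.
(* A point l = a / 32 is represented by the integer a, and the value l + m + psi l p by
   an integer upper bound of U times it; [INF] stands for no bound. *)
Definition U : Z := 16384.
Definition INF : Z := 1152921504606846976.

Section Table.
Variable M : Z.
(* The bound for a graph on m + 1 vertices is the one for m vertices plus 1 when vertex 0 is
   isolated ([c]), and L t / (L - t) with L = l (l + 1) when it is dominating; the division is only
   carried out when it beats [c]. *)
Definition dom (c x : Z) : Z :=
  if x <? M then
    if x * (M + c) <=? M * c then c else x * M / (M - x) + 1
  else INF.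
Fixpoint next (m : nat) (row old : seq Z) : seq Z :=
  match row with
  | c :: ((_ :: _) as row') =>
    match m, old with
    | S m', _ => (U + c) :: next m' row' old
    | O, x :: old' => dom (U + c) x :: next O row' old'
    | O, [::] => [::]
    end
  | _ => [::]
  end.
(* Entry [s] of row [m] bounds all graphs with [m] vertices and [s] edges. *)
Fixpoint rows (n m : nat) (row : seq Z) : seq (seq Z) :=
  match n with O => [:: row] | S n' => row :: rows n' (S m) (next m row row) end.
End Table.

Definition scaledL (a : Z) : Z := 16 * (a * (a + 32)).
Definition table (a : Z) (E : nat) : seq (seq Z) := rows (scaledL a) E 0 (512 * a :: nseq E 0).
Definition get (T : seq (seq Z)) (m s : nat) : Z := nth 0 (nth [::] T m) s.

(* No strict partition of [s] has all its parts below [d]. *)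
Definition sparse (d s : nat) : bool :=
  let dz := Z.of_nat d in dz * (dz - 1) <? 2 * Z.of_nat s.

(* Checks the bound [z] for every nonempty strict partition of [s] with parts below [m], except [D]. *)
Fixpoint bounded_except (T : seq (seq Z)) (M : Z) (D : seq nat) (s m : nat) (z : Z) : bool :=
  all (fun d : nat =>
    if (s < d)%N || sparse d (s - d)%N then true
    else
      let c := z - U * Z.of_nat (m.-1 - d)%N in
      let leaf := get T d (s - d)%N * (M + c) <=? M * c in
      (0 <? c) &&
      match D with
      | d0 :: D' => if d == d0 then bounded_except T M D' (s - d)%N d (M * c / (M + c)) else leaf
      | [::] => leaf
      end) (iota 1 m.-1).

(* For [psi_frac k p = (n, m)], with d the head of [p], k + d + 1 + psi k p = k (k + 1) n / m;
   exact, since l = k is an integer. *)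
Fixpoint psi_frac (k : Z) (p : seq nat) : Z * Z :=
  match p with
  | [::] => (1, k + 1)
  | d :: q =>
    let: (n, m) := psi_frac k q in
    let g := Z.of_nat d - (if q is d' :: _ then Z.of_nat d' + 1 else 0) in
    let: (n', m') :=
      if g =? 0 then (n, m) else (n * (k * (k + 1)) + g * m, m * (k * (k + 1))) in
    (n', m' - n')
  end.
Fixpoint good_frac (k : Z) (p : seq nat) : bool :=
  if p is d :: q then (0 <? (psi_frac k p).2) && good_frac k q else true.

(* The partition of [D_graph]. *)
Definition Dlist (k t : nat) : seq nat := mkseq (fun i => k - i - (t <= i))%N k.-1.

(* With psi_k = psi k D = pn / m, [z] encodes psi <= 2 e psi_k / (2 e + (l* - k) psi_k) at l* = a / 32, for
   the monotone quantity l - 2 e / psi to exceed k - 2 e / psi_k. *)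
Definition Dcheck (T : seq (seq Z)) (a : Z) (e k : nat) (D : seq nat) : bool :=
  let kz := Z.of_nat k in let ez := Z.of_nat e in
  let: (n, m) := psi_frac kz D in
  let pn := kz * (kz + 1) * n - (kz + Z.of_nat (head 0%N D) + 1) * m in
  let A := 64 * ez * m + (a - kz * 32) * pn in
  let z := 512 * a + ez * U + (64 * U * ez * pn - 1) / A in
  [&& good_frac kz D, 0 <? m, 0 <? pn, 32 * kz <=? a, scaledL a <? INF & bounded_except T (scaledL a) D e e z].

(* The Taylor coefficients of [cubic] at a / 32 (with [K] scaled by 1024) are nonnegative, the
   constant one positive. *)
Definition cubic_check (K a e d s : Z) : bool :=
  let c3 := 1024 * (e + d - 3) - 2 * K in
  let c2 := 2048 * (s - 1) - K * (e + d + 1) in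
  let c1 := - (1024 * (e * d)) in
  let c0 := e * (d * K - 2048 * s) in
  let h := 32 * c2 + a * c3 in
  [&& 0 <=? c3, 0 <=? h + 2 * (a * c3), 0 <=? 1024 * c1 + a * (2 * h + a * c3)
    & 0 <? 32768 * c0 + a * (1024 * c1 + a * h)].
(* At l = a / 32, (l^2 - e)^2 >= e (2 l + e + 1), which is l^2 >= e + psi l [:: e]. *)
Definition Vstart (a e : Z) : bool :=
  (1024 * e <? a * a) &&
  (e * (65536 * a + 1048576 * (e + 1)) <=? (a * a - 1024 * e) * (a * a - 1024 * e)).
(* The star wins on [a1 / 32, a / 32]: the tail of a partition d :: q satisfies
   l - 2 s / psi l q <= K, where K comes from the table at a / 32; 33554432 = 2 * 1024 * U. *)
Definition Vcheck (T : seq (seq Z)) (a a1 : Z) (e : nat) : bool :=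
  all (fun d : nat =>
    let s := (e - d)%N in
    if sparse d s then true else
    let z := get T d s in
    let dz := Z.of_nat d in let sz := Z.of_nat s in
    let psi := z - 512 * a - U * dz in
    [&& z <? INF, 0 <? psi & cubic_check (32 * a - (33554432 * sz) / psi) a1 (Z.of_nat e) dz sz])
    (iota 1 e.-1).
(* The star wins on [a1 / 32, oo[, where K bounds the first part of the tail. *)
Definition Vfinal (a1 : Z) (e : nat) : bool :=
  all (fun d : nat =>
    let s := (e - d)%N in
    if sparse d s then true else
    cubic_check (1024 * Z.of_nat (minn s d.-1)) a1 (Z.of_nat e) (Z.of_nat d) (Z.of_nat s))
    (iota 1 e.-1).

Definition tables := seq (Z * nat * seq (seq Z)).
Definition entry (Ts : tables) i := nth (0, 0%N, [::]) Ts i.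
Fixpoint chain (Ts : tables) (e : nat) (a : Z) (l : seq nat) : bool :=
  if l is j :: l' then
    let: (a', E, T) := entry Ts j in
    [&& (e <= E)%N, a <=? a', scaledL a' <? INF, Vcheck T a' a e & chain Ts e a' l']
  else Vfinal a e.
Definition clique_size (e : nat) : nat := find (fun k => 2 * e < k.+1 * k)%N (iota 0 20).
Definition checkD (Ts : tables) (e : nat) (l : seq nat) : bool :=
  let k := clique_size e in
  let D := Dlist k (e - (k * k.-1)./2)%N in
  if l is i :: l' then
    let: (a, E, T) := entry Ts i in
    [&& (k * k.-1 <= 2 * e < k.+1 * k)%N, strict D, sumn D == e, (e <= E)%N
      & Dcheck T a e k D ]
  else false.
Definition checkV (Ts : tables) (e : nat) (l : seq nat) : bool :=
  if l is i :: l' then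
    let: (a, E, T) := entry Ts i in
     Vstart a (Z.of_nat e) && chain Ts e a l'
  else false.
(* The points a / 32 together with the number of edges of their tables. *)
Definition points : seq (Z * nat) := [::
(224, 12%N); (256, 18%N); (272, 19%N); (280, 24%N); (288, 25%N); (296, 26%N); (312, 32%N); (320, 33%N);
(328, 34%N); (336, 39%N); (340, 40%N); (344, 41%N); (348, 42%N); (356, 43%N); (364, 44%N); (368, 49%N);
(372, 50%N); (376, 51%N); (380, 52%N); (388, 53%N); (396, 58%N); (398, 59%N); (400, 60%N); (404, 61%N);
(408, 62%N); (412, 63%N); (420, 64%N); (424, 65%N); (428, 70%N); (430, 71%N); (432, 72%N); (436, 73%N);
(440, 74%N); (444, 75%N); (450, 76%N); (456, 77%N); (460, 83%N); (462, 84%N); (464, 85%N); (468, 86%N);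
(472, 87%N); (476, 88%N); (482, 89%N); (488, 90%N); (490, 95%N); (492, 97%N); (494, 98%N); (498, 99%N);
(500, 100%N); (504, 101%N); (508, 102%N); (514, 103%N); (518, 104%N); (522, 110%N); (524, 111%N); (526, 112%N);
(528, 113%N); (530, 114%N); (534, 115%N); (537, 116%N); (541, 117%N); (546, 118%N); (550, 119%N); (552, 124%N);
(553, 125%N); (554, 126%N); (555, 120%N); (556, 127%N); (558, 128%N); (560, 129%N); (563, 130%N); (608, 73%N);
(640, 97%N); (672, 113%N); (704, 130%N); (736, 120%N); (768, 34%N); (832, 36%N); (960, 27%N); (1088, 130%N);
(1280, 120%N); (1600, 80%N); (2240, 130%N); (3200, 128%N); (4480, 114%N); (6400, 130%N)
].
(* For e = 4, .., 130, the indices of the points used: D wins up to the first one, the star beyond it. *)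
Definition routes : seq (seq nat) := [::
[:: 25]; [:: 26; 84]; [:: 51]; [:: 5; 85]; [:: 1; 84]; [:: 5; 85]; [:: 12; 85]; [:: 1;
85]; [:: 0; 82]; [:: 1; 84]; [:: 2; 84]; [:: 5; 85]; [:: 1; 83]; [:: 1; 81]; [:: 1; 83];
[:: 2; 81]; [:: 3; 84]; [:: 5; 82]; [:: 4; 82]; [:: 3; 77; 85]; [:: 3; 78; 85]; [:: 4; 76;
85]; [:: 5; 78; 85]; [:: 6; 78; 85]; [:: 7; 80; 85]; [:: 6; 76; 85]; [:: 6; 77; 85]; [::
6; 73; 85]; [:: 6; 75; 85]; [:: 7; 73; 85]; [:: 8; 76; 85]; [:: 9; 75; 85]; [:: 11; 77;
85]; [:: 10; 74; 85]; [:: 9; 73; 85]; [:: 9; 71; 85]; [:: 10; 72; 85]; [:: 11; 71; 85];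
[:: 12; 72; 85]; [:: 13; 72; 85]; [:: 14; 74; 85]; [:: 16; 73; 85]; [:: 15; 73; 85]; [::
15; 72; 85]; [:: 15; 72; 85]; [:: 15; 71; 85]; [:: 16; 72; 85]; [:: 17; 71; 84]; [:: 18;
72; 85]; [:: 19; 72; 85]; [:: 20; 73; 85]; [:: 23; 73; 85]; [:: 21; 73; 85]; [:: 20; 71;
82; 85]; [:: 20; 72; 83]; [:: 21; 71; 82; 85]; [:: 22; 71; 82; 85]; [:: 23; 71; 81; 85];
[:: 24; 72; 82; 85]; [:: 25; 71; 81; 85]; [:: 26; 72; 82; 85]; [:: 27; 72; 82; 85]; [::
30; 73; 82; 85]; [:: 29; 72; 81; 85]; [:: 28; 72; 81; 85]; [:: 28; 71; 81; 85]; [:: 28;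
72; 81; 85]; [:: 29; 71; 80; 85]; [:: 30; 72; 81; 85]; [:: 31; 71; 80; 85]; [:: 32; 72;
81; 85]; [:: 33; 72; 81; 85]; [:: 34; 73; 81; 85]; [:: 35; 73; 81; 85]; [:: 37; 73; 81;
85]; [:: 36; 72; 80; 85]; [:: 36; 73; 81; 85]; [:: 36; 72; 80; 85]; [:: 36; 72; 80; 85];
[:: 36; 72; 80; 85]; [:: 37; 72; 80; 85]; [:: 38; 72; 80; 85]; [:: 39; 72; 80; 85]; [::
40; 72; 80; 85]; [:: 41; 73; 80; 85]; [:: 42; 73; 80; 85]; [:: 43; 73; 80; 85]; [:: 45;
73; 80; 85]; [:: 45; 73; 80; 85]; [:: 44; 73; 80; 85]; [:: 44; 73; 80; 85]; [:: 44; 72;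
79; 85]; [:: 45; 73; 80; 85]; [:: 45; 72; 79; 85]; [:: 46; 73; 80; 85]; [:: 47; 73; 79;
85]; [:: 48; 73; 79; 85]; [:: 49; 73; 79; 85]; [:: 50; 73; 79; 85]; [:: 51; 73; 79; 85];
[:: 52; 74; 80; 85]; [:: 54; 74; 80; 85]; [:: 53; 74; 80; 85]; [:: 53; 74; 80; 85]; [::
53; 74; 80; 85]; [:: 53; 73; 79; 84; 85]; [:: 53; 73; 79; 84; 85]; [:: 54; 73; 79; 84;
85]; [:: 55; 73; 79; 84; 85]; [:: 56; 73; 79; 83; 85]; [:: 57; 74; 79; 84; 85]; [:: 58;
74; 79; 83; 85]; [:: 59; 74; 79; 83; 85]; [:: 60; 74; 79; 83; 85]; [:: 61; 74; 79; 83;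
85]; [:: 62; 74; 79; 83; 85]; [:: 66; 75; 80; 85]; [:: 64; 74; 79; 83; 85]; [:: 64; 74;
79; 83; 85]; [:: 63; 74; 79; 83; 85]; [:: 63; 74; 79; 83; 85]; [:: 64; 74; 79; 83; 85];
[:: 65; 74; 79; 83; 85]; [:: 67; 74; 79; 83; 85]; [:: 68; 74; 79; 83; 85]; [:: 69; 74; 79;
82; 85]; [:: 70; 74; 79; 82; 85]
]%N.
Definition check_all ok :=
  let Ts := [seq (p.1, p.2, table p.1 p.2) | p <- points] in
  all (fun c : nat * seq nat => ok Ts c.1 c.2) (zip (iota 4 127) routes).
End Program.

Lemma check_all_ok : check_all (fun T e l => checkD T e l && checkV T e l) = true.
Proof. by vm_cast_no_check (erefl true). Qed.

(** * Soundness of the tables *)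

Delimit Scope Z_scope with ZZ.

Section ZR.
Variable R : realFieldType.
Definition ZR (z : Z) : R := (int_of_Z z)%:~R.
Lemma ZRD x y : ZR (Z.add x y) = ZR x + ZR y.
Proof. by rewrite /ZR -intrD -(rmorphD int_of_Z). Qed.
Lemma ZRM x y : ZR (Z.mul x y) = ZR x * ZR y.
Proof. by rewrite /ZR -intrM -(rmorphM int_of_Z). Qed.
Lemma ZRN x : ZR (Z.opp x) = - ZR x.
Proof. by rewrite /ZR -rmorphN -(rmorphN int_of_Z). Qed.
Lemma ZRB x y : ZR (Z.sub x y) = ZR x - ZR y.
Proof. by rewrite -Z.add_opp_r ZRD ZRN. Qed.
Lemma ZR_nat n : ZR (Z.of_nat n) = n%:R.
Proof. by rewrite /ZR; have -> : int_of_Z (Z.of_nat n) = n%:Z by lia. Qed.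
Lemma ZR_le x y : (ZR x <= ZR y) = Z.leb x y.
Proof. by rewrite /ZR ler_int; lia. Qed.
Lemma ZR_lt x y : (ZR x < ZR y) = Z.ltb x y.
Proof. by rewrite /ZR ltr_int; lia. Qed.
Lemma ZR0 : ZR Z0 = 0. Proof. by []. Qed.
Lemma ZR1 : ZR (Zpos xH) = 1. Proof. by []. Qed.
Lemma ZR_xO p : ZR (Zpos (xO p)) = 2 * ZR (Zpos p).
Proof. by rewrite Pos2Z.inj_xO ZRM. Qed.
Lemma ZR_xI p : ZR (Zpos (xI p)) = 2 * ZR (Zpos p) + 1.
Proof. by rewrite Pos2Z.inj_xI ZRD ZRM. Qed.
Definition ZRE := (ZRD, ZRM, ZRB, ZRN, ZR_nat, ZR0, ZR1, ZR_xO, ZR_xI).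
Lemma ZR_divl x y : Z.lt 0 y -> ZR (Z.div x y) * ZR y <= ZR x.
Proof. move=> y0; rewrite -ZRM ZR_le; have := Z.mul_div_le x y y0; lia. Qed.
Lemma ZR_divr x y : Z.lt 0 y -> ZR x < (ZR (Z.div x y) + 1) * ZR y.
Proof.
move=> y0; rewrite -ZR1.
by rewrite -ZRD -ZRM ZR_lt; have := Z.mul_succ_div_gt x y y0; lia.
Qed.
End ZR.

Global Opaque ZR.

Definition fits (m : nat) (p : seq nat) : bool := if p is d :: _ then (d < m)%N else true.

Section Table.
Variables (R : realFieldType) (a : Z) (l : R).
Local Notation ZR := (ZR R).
Hypotheses (ZRa : ZR a = 32 * l) (a0 : Z.lt 0 a) (Msmall : Z.lt (scaledL a) INF).

(** In this normalisation an isolated vertex adds the constant [U], and a dominating vertex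
    subtracts 1 / M from the reciprocal, M being [scaledL a]. Both maps are increasing, which is
    what makes dynamic programming on upper bounds sound. *)
Definition tval (m : nat) (p : seq nat) : R := 16384 * (l + m%:R + psi l p).

Definition bnd (x : R) (z : Z) : Prop := Z.lt z INF -> x <= ZR z.

Lemma l_gt0 : 0 < l.
Proof.
have : 0 < ZR a by rewrite -(ZR0 R) ZR_lt; lia.
by rewrite ZRa; lra.
Qed.
Lemma ZR_scaledL : ZR (scaledL a) = 16384 * (l * (l + 1)).
Proof. by rewrite /scaledL !ZRE ZRa; lra. Qed.
Lemma scaledL_gt0 : Z.lt 0 (scaledL a). Proof. by rewrite /scaledL; lia. Qed.

Lemma tvalS m p : tval m.+1 p = tval m p + ZR U.
Proof. by rewrite /tval -[m.+1]addn1 natrD /U !ZRE; lra. Qed.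

Lemma tval_le m m' p : (m <= m')%N -> tval m' p = tval m p + ZR U * (m' - m)%N%:R.
Proof. by move=> h; rewrite /tval natrB // /U !ZRE; lra. Qed.

Lemma tval_cons d q : good l (d :: q) ->
  let M := ZR (scaledL a) in
  tval d q < M /\ tval d.+1 (d :: q) = M * tval d q / (M - tval d q).
Proof.
move=> /andP[hg _] M; have l0 := l_gt0.
have h : tval d q < M by rewrite /tval /M ZR_scaledL ltr_pM2l.
split=> //; rewrite /M ZR_scaledL /tval [psi _ (_ :: _)]/=.
have n : l * (l + 1) - (l + d%:R + psi l q) != 0 by lra.
by field; rewrite n andbT -mulrBr mulf_neq0 // pnatr_eq0.
Qed.

Lemma frac_le (M x y : R) : x <= y -> y < M -> 0 < M -> M * x / (M - x) <= M * y / (M - y).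
Proof.
move=> xy yM M0; rewrite ler_pdivrMr; last lra.
rewrite mulrAC ler_pdivlMr; last lra.
have : 0 <= M * M * (y - x) by rewrite mulr_ge0 // ?mulr_ge0; lra.
lra.
Qed.

Lemma dom_sound (c x : Z) (v w : R) : v <= ZR (scaledL a) * w / (ZR (scaledL a) - w) -> bnd w x ->
  bnd v (dom (scaledL a) c x).
Proof.
move=> hv hw; have M0 := scaledL_gt0.
have M0R : 0 < ZR (scaledL a) by rewrite -(ZR0 R) ZR_lt; lia.
rewrite /dom; case: Z.ltb_spec => // xM.
have wx : w <= ZR x by apply: hw; lia.
have xMR : ZR x < ZR (scaledL a) by rewrite ZR_lt; lia.
have le1 := le_trans hv (frac_le wx xMR M0R).
case: Z.leb_spec => hc _; apply: le_trans le1 _.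
  rewrite ler_pdivrMr ?subr_gt0 //.
  have : ZR (x * (scaledL a + c))%ZZ <= ZR (scaledL a * c)%ZZ by rewrite ZR_le; lia.
  by rewrite !ZRE; lra.
rewrite ler_pdivrMr ?subr_gt0 // ZRD ZR1.
have := @ZR_divr R (x * scaledL a)%ZZ (scaledL a - x)%ZZ; rewrite ZRM ZRB => h.
by rewrite [_ * ZR _]mulrC; apply/ltW/h; lia.
Qed.

Lemma dom_ge (c x : Z) : Z.lt (dom (scaledL a) c x) INF -> Z.le c (dom (scaledL a) c x).
Proof.
have M0 := scaledL_gt0; rewrite /dom; case: Z.ltb_spec => // xM.
case: Z.leb_spec => hc _; first lia.
have d0 : Z.lt 0 (scaledL a - x) by lia.
have h := Z.mul_succ_div_gt (x * scaledL a)%ZZ _ d0; nia.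
Qed.

Definition row_ok E m (row : seq Z) : Prop :=
  size row = (E - m).+1 /\
  forall s p, (m + s <= E)%N -> strict p -> good l p -> sumn p = s -> fits m p ->
    bnd (tval m p) (nth Z0 row s).

Lemma size_next m row old : (size row <= (size old).+1 + m)%N ->
  size (next (scaledL a) m row old) = (size row).-1.
Proof.
elim: row m old => // c row IH m old; case: row IH => // c' row IH.
case: m => [|m] h; rewrite /= in h.
  case: old h => [|x old] h; rewrite /= in h; first lia.
  by rewrite -[LHS]/(size (next (scaledL a) 0 (c' :: row) old)).+1 IH //=; lia.
by rewrite -[LHS]/(size (next (scaledL a) m (c' :: row) old)).+1 IH //=; lia.
Qed.

Lemma nth_next m row old s : (s.+1 < size row)%N -> (size row <= (size old).+1 + m)%N ->
  nth Z0 (next (scaledL a) m row old) s =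
  let c := (U + nth Z0 row s)%ZZ in
  if (s < m)%N then c else dom (scaledL a) c (nth Z0 old (s - m)).
Proof.
elim: row m old s => // c row IH m old s; case: row IH => // c' row IH.
case: m => [|m] hs h; rewrite /= in hs h.
  case: old h => [|x old] h; rewrite /= in h; first lia.
  case: s hs => [|s] hs //.
  by rewrite -[LHS]/(nth Z0 (next (scaledL a) 0 (c' :: row) old) s) IH //= ?subn0 //; lia.
case: s hs => [|s] hs //.
by rewrite -[LHS]/(nth Z0 (next (scaledL a) m (c' :: row) old) s) IH //=; lia.
Qed.

Lemma next_ok E m row : (m < E)%N -> row_ok E m row -> row_ok E m.+1 (next (scaledL a) m row row).
Proof.
move=> mE [sz ok]; split; first by rewrite size_next ?sz; lia.
move=> s p hs st gd sp ft.
rewrite nth_next ?sz; try lia.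
have iso : fits m p -> bnd (tval m.+1 p) (U + nth Z0 row s)%ZZ.
  move=> fm hc; rewrite tvalS ZRD addrC lerD2l.
  apply: ok => //; first lia.
  move: hc; rewrite /U; lia.
cbv zeta; case: ltnP => sm.
  apply: iso; case: p st sp ft {gd} => //= d q _ sp _; lia.
case: p st gd sp ft iso => [|d q] st gd sp ft iso.
  move=> hd; apply: le_trans (iso isT _) _; first by have := dom_ge hd; lia.
  by rewrite ZR_le; have := dom_ge hd; lia.
have [dm|dm] := eqVneq d m; last first.
  have fm : fits m (d :: q) by rewrite /= in ft *; lia.
  move=> hd; apply: le_trans (iso fm _) _; first by have := dom_ge hd; lia.
  by rewrite ZR_le; have := dom_ge hd; lia.
subst d; have [lt1 e1] := tval_cons gd.
apply: dom_sound; first by rewrite e1.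
apply: ok; rewrite /= in sp.
- lia.
- by case/andP: st.
- by case/andP: gd.
- lia.
- by case: (q) st => //= d r /andP[].
Qed.

Lemma rows_ok E n m row i : (n + m = E)%N -> row_ok E m row -> (i <= n)%N ->
  row_ok E (m + i) (nth [::] (rows (scaledL a) n m row) i).
Proof.
elim: n m row i => [|n IH] m row i /= nE ok.
  by case: i => // _; rewrite addn0.
case: i => [|i] hi; first by rewrite addn0.
by rewrite -addSnnS; apply: IH => //; [lia|apply: next_ok => //; lia].
Qed.

Lemma table_ok E m s p : (m + s <= E)%N -> strict p -> good l p -> sumn p = s -> fits m p ->
  bnd (tval m p) (get (table a E) m s).
Proof.
move=> hE st gd sp ft.
(* Without vertices only the empty partition fits; the zeros at positive numbers of edges bound an
   empty set. *)
have ok0 : row_ok E 0 ((512 * a)%ZZ :: nseq E Z0).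
  split; first by rewrite /= size_nseq subn0.
  move=> s0 [|d q] // _ _ _ <- _ _.
  by rewrite -[nth _ _ _]/(512 * a)%ZZ /tval -[psi _ _]/(0 : R) !ZRE ZRa; lra.
have mE : (m <= E)%N by lia.
have [_ ok] := @rows_ok E E 0 _ m (addn0 E) ok0 mE.
exact: ok.
Qed.

End Table.

Local Opaque scaledL U INF.

Lemma sparseP d s : (2 * s + d <= d * d)%N -> sparse d s = false.
Proof.
by move=> h; rewrite /sparse; apply/negbTE/negP => /Z.ltb_spec0; nia.
Qed.

(** * Bounding every partition except a given one *)

Section Check.
Variables (R : realFieldType) (a : Z) (l : R).
Local Notation ZR := (ZR R).
Hypotheses (ZRa : ZR a = 32 * l) (a0 : Z.lt 0 a) (Msmall : Z.lt (scaledL a) INF).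
Variables (E : nat) (T : seq (seq Z)).
Hypothesis T_ok : forall m s p, (m + s <= E)%N -> strict p -> good l p -> sumn p = s ->
  fits m p -> bnd (tval l m p) (get T m s).

(** The budget [z] is pulled back to the tail: [c] removes the isolated vertices, and M w / (M - w)
    <= c means w <= M c / (M + c). *)
Lemma tval_dom_le d q m (z : Z) :
  let c := (z - U * Z.of_nat (m.-1 - d)%N)%ZZ in
  (d < m)%N -> good l (d :: q) -> Z.lt 0 c ->
  tval l d q * ZR (scaledL a + c)%ZZ <= ZR (scaledL a * c)%ZZ -> tval l m (d :: q) <= ZR z.
Proof.
move=> c dm gd.
have zE : ZR z = ZR c + ZR U * (m.-1 - d)%N%:R by rewrite /c ZRB ZRM ZR_nat; ring.
clearbody c; rewrite ZRD ZRM => c0 hc.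
have [lt1 e1] := tval_cons ZRa a0 gd.
rewrite (tval_le l (d :: q) dm) e1.
have -> : (m - d.+1)%N = (m.-1 - d)%N by lia.
rewrite zE lerD2r ler_pdivrMr ?subr_gt0 //.
lra.
Qed.

(** A competitor agrees with [D] up to some part and then leaves it. Along the common part the
    budget is pulled back, rounded down; from the first different part on, the table bounds the
    tail. The table alone would not do, since its maxima range over [D] as well. *)
Lemma bounded_except_ok D s m z : (s <= E)%N -> strict D -> sumn D = s -> bounded_except T (scaledL a) D s m z ->
  forall p, strict p -> good l p -> sumn p = s -> fits m p -> p != [::] -> p != D ->
  tval l m p <= ZR z.
Proof.
have M0 := scaledL_gt0 a0.
have leaf_ok d q s1 c : (d + s1 <= E)%N -> strict (d :: q) -> good l (d :: q) -> sumn q = s1 ->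
    Z.lt 0 c -> (get T d s1 * (scaledL a + c) <=? scaledL a * c)%ZZ ->
    tval l d q * ZR (scaledL a + c)%ZZ <= ZR (scaledL a * c)%ZZ.
  move=> hE /andP[hd st] /andP[_ gd] hs c0 /Z.leb_spec0 hg.
  have hb : tval l d q <= ZR (get T d s1).
    apply: T_ok => //; last by nia.
    by case: (q) hd => //= ? ?; lia.
  apply: (@le_trans _ _ (ZR (get T d s1 * (scaledL a + c))%ZZ)); last by rewrite ZR_le; lia.
  by rewrite ZRM ler_wpM2r // -(ZR0 R) ZR_le; lia.
elim: D s m z => [|d0 D IH] s m z sE stD sD /allP hchk [|d q] // stp gp sp fp _ pD.
  rewrite -sD in sp; case/andP: stp => /(leq_ltn_trans (leq0n _)); rewrite /= in sp; lia.
have d0p : (0 < d)%N by case/andP: stp => /(leq_ltn_trans (leq0n _)).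
have dm : (d < m)%N by [].
rewrite /= in sp.
have qE : (sumn q <= E)%N by rewrite (leq_trans _ sE) // -sp leq_addl.
have din : d \in iota 1 m.-1 by rewrite mem_iota; lia.
have := hchk d din.
have s1E : (s - d)%N = sumn q by lia.
have -> : (s < d)%N = false by lia.
rewrite s1E sparseP /=; last exact: strict_tail_sum.
case: eqP => [dd|/eqP dd] /andP[/Z.ltb_spec0 c0 hc]; apply: tval_dom_le => //.
  subst d0; move: hc; set c := (_ - _)%ZZ in c0 *; move=> hc.
  have qD : q != D by apply: contra pD => /eqP ->.
  have sDq : sumn D = sumn q by apply: (@addnI d); rewrite sp -sD.
  have q0 : q != [::].
    apply: contra qD => /eqP q0; move: sDq stD; rewrite q0.
    by case: (D) => //= e r sD0 /andP[_ /andP[]]; lia.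
  have [/andP[h1 st1] /andP[_ g1]] := (stp, gp).
  have ft1 : fits d q by case: (q) h1 => //= ? ?; lia.
  have stD' : strict D by case/andP: stD.
  have hle := IH (sumn q) d _ qE stD' sDq hc q st1 g1 erefl ft1 q0 qD.
  have Mc0 : Z.lt 0 (scaledL a + c) by apply: Z.add_pos_pos.
  apply: le_trans (ZR_divl R (scaledL a * c) Mc0).
  rewrite ler_wpM2r // -(ZR0 R) ZR_le; exact/Z.leb_spec0/Z.lt_le_incl.
by apply: leaf_ok hc => //; rewrite sp.
Qed.
End Check.

Lemma psi_frac_ok (R : realFieldType) (k : nat) p : (0 < k)%N -> strict p ->
  good_frac (Z.of_nat k) p ->
  let: (n, m) := psi_frac (Z.of_nat k) p in
  [/\ good (k%:R : R) p, Z.lt 0 m &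
   (k%:R + (if p is d :: _ then d.+1 else 0%N)%:R + psi k%:R p) * ZR R m = k%:R * (k%:R + 1) * ZR R n].
Proof.
move=> k0; elim: p => [|d q IH] st.
  move=> _ /=; split=> //; first lia.
  by rewrite !ZRE; lra.
have stq : strict q by case/andP: st.
rewrite [good_frac _ _]/= => /andP[] /[swap] /(IH stq) {IH}.
rewrite /=; case: (psi_frac _ q) => n m [gq m0 E].
set v := (if q is d' :: _ then _ else 0)%N in E.
set g := (Z.of_nat d - _)%ZZ.
have vE : ZR R g = d%:R - v%:R.
  by rewrite /g /v; case: (q) => [|d' r]; rewrite !ZRE // -[d'.+1]addn1 natrD.
clearbody g.
have kk0 : 0 < (k%:R : R) by rewrite ltr0n.
have m0R : 0 < ZR R m by rewrite -(ZR0 R) ZR_lt; lia.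
(* [g] counts the isolated vertices between the tail and the new vertex. For g = 0 the pair is
   reused, which saves a factor k (k + 1); consecutive parts of [Dlist] mostly differ by one, so the
   integers stay small. *)
set w := if _ then (n, m) else _.
have [w0 wE] : 0 < ZR R w.2 /\ (k%:R + d%:R + psi k%:R q) * ZR R w.2 = k%:R * (k%:R + 1) * ZR R w.1.
  rewrite /w; case: Z.eqb_spec => [g0|_] /=.
    split=> //; rewrite -E; congr (_ * _).
    by have : ZR R g = 0 by [rewrite g0]; rewrite vE; lra.
  rewrite !ZRE; split; first by rewrite !mulr_gt0 //; lra.
  rewrite vE.
  have -> : (k%:R + d%:R + psi k%:R q) * (ZR R m * (k%:R * (k%:R + 1))) =
     k%:R * (k%:R + 1) * ((k%:R + v%:R + psi k%:R q) * ZR R m + (d%:R - v%:R) * ZR R m) by ring.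
  by rewrite E; ring.
case: w w0 wE => n' m' /= w0 wE /Z.ltb_spec0 h.
have lt1 : ZR R n' < ZR R m' by rewrite ZR_lt; lia.
have L0 : 0 < k%:R * (k%:R + 1) :> R by rewrite mulr_gt0 //; lra.
have hg : (k%:R : R) + d%:R + psi k%:R q < k%:R * (k%:R + 1).
  rewrite ltNge; apply/negP => hge; have := ler_wpM2r (ltW w0) hge.
  by rewrite wE ler_pM2l // leNgt lt1.
split; [by rewrite hg| lia |].
rewrite ZRB; move: hg wE; set L : R := k%:R * (k%:R + 1) in L0 *; set t : R := k%:R + d%:R + psi k%:R q => hg wE.
have n0 : L - t != 0 by lra.
have -> : k%:R + d.+1%:R + (L * t / (L - t) - k%:R - d.+1%:R) = L * (t / (L - t)) by ring.
rewrite -mulrA; congr (_ * _); apply: (mulIf n0); rewrite mulrAC divfK //; lra.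
Qed.

(** * Comparison of partitions *)

Section Phases.
Variable R : realFieldType.
Implicit Types l : R.

Lemma sumn0_strict q : strict q -> sumn q = 0%N -> q = [::].
Proof. by case: q => // d q /andP[/(leq_ltn_trans (leq0n _))]; case: d. Qed.

(** Only the star needs e + 1 vertices, so all its competitors can be bounded on e vertices. *)
Lemma strict_fits p e : strict p -> sumn p = e -> p != [:: e] -> fits e p.
Proof.
case: p => // d q st /= <- pe; rewrite -[X in (X < _)%N]addn0 ltn_add2l lt0n.
apply: contra pe => /eqP q0; case/andP: st => _ sq.
by rewrite q0 addn0 (sumn0_strict sq q0).
Qed.

(** With phi = l - E2 / psi, the three inequalities read phi(k, D) <= phi(l, D), phi(l, p) <=
    phi(l2, p) and phi(l2, p) < phi(k, D). Hence phi(l, p) < phi(l, D), that is, x < Pl.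
    Denominators are cleared because x and x2 may vanish. *)
Lemma increment_compare (E2 k l l2 P Pl x x2 : R) :
  0 < E2 -> 0 < P -> 0 <= Pl -> 0 <= x -> 0 <= x2 -> k <= l -> l <= l2 ->
  E2 * (P - Pl) <= (l - k) * (P * Pl) -> E2 * (x - x2) <= (l2 - l) * (x * x2) ->
  x2 * (E2 + (l2 - k) * P) < E2 * P -> x < Pl.
Proof.
move=> e0 P0 Pl0 x0 x20 kl ll2 h1 h2 h3; rewrite ltNge; apply/negP => Plx.
have Y0 : 0 < E2 + (l2 - l) * x by apply: ltr_pwDl => //; apply: mulr_ge0 => //; lra.
have Z0 : 0 < E2 + (l2 - k) * P.
  by apply: ltr_pwDl => //; apply: mulr_ge0; [lra|exact: ltW].
have hA : E2 * x * (E2 + (l2 - k) * P) < E2 * P * (E2 + (l2 - l) * x).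
  apply: (@le_lt_trans _ _ (x2 * (E2 + (l2 - k) * P) * (E2 + (l2 - l) * x))).
    have : E2 * x <= x2 * (E2 + (l2 - l) * x) by lra.
    by move/(ler_wpM2r (ltW Z0)); lra.
  by rewrite ltr_pM2r.
have hB : x * (E2 + (l2 - k) * P) < P * (E2 + (l2 - l) * x).
  by rewrite -(ltr_pM2l e0) !mulrA.
have W0 : 0 <= E2 + (l - k) * P by apply: addr_ge0; [exact: ltW|apply: mulr_ge0; [lra|exact: ltW]].
have := ler_wpM2r W0 Plx.
lra.
Qed.

Lemma ZR_U : ZR R U = 16384. Proof. by rewrite !ZRE; lra. Qed.
Lemma ZR_32 : ZR R 32 = 32. Proof. by rewrite !ZRE; lra. Qed.
Lemma ZR_64 : ZR R 64 = 64. Proof. by rewrite !ZRE; lra. Qed.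
Lemma ZR_512 : ZR R 512 = 512. Proof. by rewrite !ZRE; lra. Qed.

(** The -1 in the integer quotient of [Dcheck] turns its rounded bound into a strict inequality. *)
Lemma quotient_bound (x y w A e m pn : R) : 0 < A ->
  A = 64 * e * m + 32 * y * pn -> 16384 * x <= w -> w * A <= 64 * 16384 * e * pn - 1 ->
  x * (2 * e * m + y * pn) < 2 * e * pn.
Proof. by move=> A0 AE /(ler_wpM2r (ltW A0)); rewrite AE; lra. Qed.

Definition sound_table l E T := forall m s p, (m + s <= E)%N -> strict p -> good l p ->
  sumn p = s -> fits m p -> bnd (tval l m p) (get T m s).

Lemma Dcheck_ok (a : Z) (E e k : nat) T D l2 : ZR R a = 32 * l2 -> sound_table l2 E T ->
  (e <= E)%N -> (0 < e)%N -> (0 < k)%N -> strict D -> sumn D = e -> Dcheck T a e k D ->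
  forall l, k%:R <= l -> l <= l2 -> good l D /\
  forall p, strict p -> good l p -> sumn p = e -> p != D -> p != [:: e] -> psi l p < psi l D.
Proof.
move=> la T_ok eE e0 k0 stD sD.
rewrite /Dcheck; have := psi_frac_ok R k0 stD; case: (psi_frac _ _) => n m hz.
set pn := (_ * n - _)%ZZ; set A := (_ + _ * pn)%ZZ.
case/andP=> zg /andP[/Z.ltb_spec0 m0 /andP[/Z.ltb_spec0 pn0 /andP[/Z.leb_spec0 ka]]].
case/andP=> /Z.ltb_spec0 Msmall hchk l kl ll2.
have {hz}[gk _ hz] := hz zg.
have kR : 0 < k%:R :> R by rewrite ltr0n.
have [gD le_psi _] := psi_bilinear kR kl stD gk.
split=> // p stp gp sp pD pe.
have l0 : 0 < l by lra.
have pn_R : 0 < ZR R pn by rewrite -(ZR0 R) ZR_lt; apply/Z.ltb_spec0.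
have m_R : 0 < ZR R m by rewrite -(ZR0 R) ZR_lt; apply/Z.ltb_spec0.
have pnE : psi (k%:R : R) D * ZR R m = ZR R pn.
  move: hz; rewrite /pn !ZRE; case: (D) sD => [|d q] /=; first by move=> e00; rewrite -e00 in e0.
  by rewrite -[d.+1]addn1 natrD; lra.
have P0 : 0 < psi (k%:R : R) D by rewrite -(pmulr_lgt0 _ m_R) pnE.
have A_E : ZR R A = 64 * e%:R * ZR R m + 32 * (l2 - k%:R) * ZR R pn.
  by rewrite /A; clearbody pn; rewrite !ZRE la; ring.
have eR : 0 < e%:R :> R by rewrite ltr0n.
have A_R : 0 < ZR R A.
  rewrite A_E ltr_pwDl // ?mulr_gt0 //; last by rewrite mulr_ge0 ?(ltW pn_R) // mulr_ge0 //; lra.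
have A0 : Z.lt 0 A by move: A_R; rewrite -(ZR0 R) ZR_lt => /Z.ltb_spec0.
have a0 : Z.lt 0 a by move: k0 ka; clear; lia.
have [g2 le2 _] := psi_bilinear l0 ll2 stp gp.
have hb : tval l2 e p <= ZR R (512 * a + Z.of_nat e * U + (64 * U * Z.of_nat e * pn - 1) / A)%ZZ.
  apply: (bounded_except_ok la a0 Msmall T_ok eE stD sD hchk) => //; first exact: strict_fits.
  by apply: contraTneq e0 => p0; rewrite -sp p0.
have hd := ZR_divl R (64 * U * Z.of_nat e * pn - 1) A0.
have x2b : psi l2 p * (2 * e%:R + (l2 - k%:R) * psi (k%:R : R) D) < 2 * e%:R * psi (k%:R : R) D.
  rewrite -(ltr_pM2r m_R) -[_ * _ * ZR R m]mulrA mulrDl.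
  rewrite -[(l2 - _) * _ * _]mulrA -[2 * e%:R * _ * _]mulrA pnE.
  apply: (@quotient_bound _ _ (ZR R (Z.div (64 * U * Z.of_nat e * pn - 1) A)) (ZR R A)) => //.
    by move: hb; rewrite /tval !ZRD !ZRM ZR_nat ZR_U ZR_512 la; move: (ZR R _) => w; clear; lra.
  by move: hd; rewrite ZRB !ZRM ZR_nat ZR_U ZR_64 ZR1.
have il := psi_increment kR kl stD gk.
have ip := psi_increment l0 ll2 stp gp.
rewrite sD in il; rewrite sp in ip.
have [[Pl0 _ _] [x0 _ _]] := (good_psi_bounds l0 stD gD, good_psi_bounds l0 stp gp).
have [|x20 _ _] := good_psi_bounds (_ : 0 < l2) stp g2; first lra.
by apply: increment_compare il ip x2b => //; rewrite mulr_gt0.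
Qed.

(* With psi l [:: e] - psi l (d :: q) of the sign of s N2 - psi l q N1 (see [star_wins]), this
   is (l - K) N2 - 2 N1. *)
Definition cubic (l K e d s : R) : R :=
  (e + d - 3 - 2 * K) * l ^+ 3 + (2 * (s - 1) - K * (e + d + 1)) * l ^+ 2
  - e * d * l + e * (d * K - 2 * s).

Lemma cubic_check_ok K a l l1 e d s : ZR R a = 32 * l1 -> 0 <= l1 -> cubic_check K a e d s -> l1 <= l ->
  0 < cubic l (ZR R K / 1024) (ZR R e) (ZR R d) (ZR R s).
Proof.
move=> la l10; rewrite /cubic_check.
set c3 := (1024 * _ - _)%ZZ; set c2 := (2048 * _ - _)%ZZ; set c1 := Z.opp _; set c0 := (e * _)%ZZ.
have [E3 E2 E1 E0] : [/\ ZR R c3 = 1024 * (ZR R e + ZR R d - 3) - 2 * ZR R K,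
   ZR R c2 = 2048 * (ZR R s - 1) - ZR R K * (ZR R e + ZR R d + 1),
   ZR R c1 = - (1024 * (ZR R e * ZR R d)) & ZR R c0 = ZR R e * (ZR R d * ZR R K - 2048 * ZR R s)].
  by rewrite /c3 /c2 /c1 /c0 !ZRE; split; clear; lra.
move=> H ll1; move: H; clearbody c3 c2 c1 c0.
case/and4P; rewrite -!(ZR_le R) -!(ZR_lt R) !ZRE la => h3 h2 h1 h0.
have [h lE] : exists h, l = l1 + h by exists (l - l1); lra.
have h_ge0 : 0 <= h by lra.
have -> : cubic l (ZR R K / 1024) (ZR R e) (ZR R d) (ZR R s) =
  (ZR R c3 * l ^+ 3 + ZR R c2 * l ^+ 2 + ZR R c1 * l + ZR R c0) / 1024.
  by rewrite /cubic E3 E2 E1 E0; field.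
rewrite divr_gt0 // lE.
move: h3 h2 h1 h0 h_ge0; move: (ZR R c3) (ZR R c2) (ZR R c1) (ZR R c0) => x3 x2 x1 x0.
clear -l10 => h3 h2 h1 h0 h_ge0.
have t2 : 0 <= h * h * (x2 + 3 * l1 * x3) by apply: mulr_ge0; [exact: mulr_ge0|lra].
have t1 : 0 <= h * (x1 + 2 * l1 * x2 + 3 * l1 * l1 * x3) by apply: mulr_ge0 => //; lra.
have t3 : 0 <= h * h * h * x3 by do 3?apply: mulr_ge0 => //.
lra.
Qed.

Lemma psi1 l e : l * l - e%:R != 0 ->
  psi l [:: e] = e%:R * (2 * l + e%:R + 1) / (l * l - e%:R).
Proof.
move=> h; rewrite /= addr0 -[e.+1]addn1 natrD.
have h' : l * (l + 1) - (l + e%:R) != 0 by have -> : l * (l + 1) - (l + e%:R) = l * l - e%:R by ring.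
by field.
Qed.

(** Only the tail enters: clearing denominators, the claim becomes x N1 < s N2 with x = [psi l q].
    Since x (l - K) <= 2 s, it is enough that 2 N1 < (l - K) N2, a cubic inequality in l. *)
Lemma star_wins l K d q e : 0 < l -> strict (d :: q) -> good l (d :: q) ->
  sumn (d :: q) = e -> (0 < sumn q)%N -> e%:R < l * l ->
  psi l q * (l - K) <= 2 * (sumn q)%:R ->
  0 < cubic l K e%:R d%:R (sumn q)%:R -> psi l (d :: q) < psi l [:: e].
Proof.
move=> l0 st gd se s0 el hK hP.
have n1 : l * l - e%:R != 0 by lra.
have [hg sq gq] : [/\ l + d%:R + psi l q < l * (l + 1), strict q & good l q].
  by case/andP: gd => hg gq; case/andP: st => _ sq; split.
have [x0 _ _] := good_psi_bounds l0 sq gq.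
rewrite psi1 // [psi l (d :: q)]/=.
set x := psi l q in x0 hg hK *.
have sE : e%:R = (sumn q)%:R + d%:R :> R by rewrite -natrD addnC -se.
have sR : 0 < (sumn q)%:R :> R by rewrite ltr0n.
have d0 : 0 <= d%:R :> R by [].
rewrite -[d.+1]addn1 natrD.
move: hg hK hP el n1; rewrite sE; move: (sumn q)%:R d%:R sR d0 => s e1 sR d0.
move: x x0 => x x0; clear -l0 sR d0 x0 => hg hK hP el n1.
have D1 : 0 < l * l - e1 - x by lra.
have -> : l * (l + 1) * (l + e1 + x) / (l * (l + 1) - (l + e1 + x)) - l - (e1 + 1) =
   (l * l * x + (2 * l + e1 + 1) * (e1 + x)) / (l * l - e1 - x).
  by field; lra.
rewrite ltr_pdivrMr // [ltRHS]mulrAC ltr_pdivlMr; last lra.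
set N1 := (l * l + 2 * l + e1 + 1) * (l * l - (s + e1)) + (s + e1) * (2 * l + (s + e1) + 1).
set N2 := 2 * l ^+ 3 + ((s + e1) + e1 + 1) * l ^+ 2 - (s + e1) * e1.
have PE : cubic l K (s + e1) e1 s = (l - K) * N2 - 2 * N1 by rewrite /cubic /N1 /N2; ring.
have N1p : 0 < N1.
  apply: addr_gt0; first by apply: mulr_gt0; [nra|lra].
  by apply: mulr_gt0; lra.
have N2p : 0 < N2.
  have : (s + e1) * (s + e1 + e1 + 1) <= l * l * (s + e1 + e1 + 1) by apply: ler_wpM2r; lra.
  have : 0 < l ^+ 3 by rewrite exprn_gt0.
  by rewrite /N2; nra.
have lK : 0 < l - K by rewrite -(pmulr_lgt0 _ N2p); lra.
have hN : x * N1 < s * N2.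
  rewrite -(ltr_pM2r lK).
  have h1 : x * (l - K) * N1 <= 2 * s * N1 by apply: ler_wpM2r => //; exact: ltW.
  have h2 : 0 < s * ((l - K) * N2 - 2 * N1) by apply: mulr_gt0 => //; lra.
  lra.
by rewrite /N1 /N2 in hN; lra.
Qed.

Definition star_dominates l e := forall p, strict p -> good l p -> sumn p = e ->
  p != [:: e] -> psi l p < psi l [:: e].

Lemma cons_of_sum e p : strict p -> sumn p = e -> p != [:: e] -> (0 < e)%N ->
  exists d q, [/\ p = d :: q, (0 < sumn q)%N, (e - d)%N = sumn q, d \in iota 1 e.-1 &
    (2 * sumn q + d <= d * d)%N].
Proof.
move=> st sp pe e0; have ft := strict_fits st sp pe.
case: p st sp pe ft => [|d q] st /= sp pe ft; first by rewrite -sp in e0.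
have s0 : (0 < sumn q)%N by lia.
exists d, q; split=> //; first by rewrite -sp addKn.
  have : (0 < d)%N by case/andP: st => /(leq_ltn_trans (leq0n _)).
  by rewrite mem_iota; lia.
exact: strict_tail_sum.
Qed.

Lemma scaled_bound (B C r x y s : R) : 0 < B -> 0 < C -> 0 <= r ->
  B * x <= y -> r * y <= B * (2 * C) * s -> r / C * x <= 2 * s.
Proof.
move=> B0 C0 r0 /(ler_wpM2l r0) h1 h2; rewrite mulrAC ler_pdivrMr // -(ler_pM2l B0).
lra.
Qed.

(** Monotonicity of l - 2 s / psi for the tail: its value at l is at most the one at l2, hence at
    most l2 - K. *)
Lemma secant_bound (l l2 K x x2 s : R) : 0 < s -> 0 <= x -> 0 <= x2 ->
  2 * s * (x - x2) <= (l2 - l) * (x * x2) -> K * x2 <= 2 * s -> x * (l - (l2 - K)) <= 2 * s.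
Proof.
move=> s0 x0 x20 h hk; have [x200|x2n] := eqVneq x2 0.
  have h' : 2 * s * x <= 0 by move: h; rewrite x200; lra.
  have xle0 : x <= 0 by move: h'; rewrite pmulr_rle0 //; lra.
  by have -> : x = 0 by [lra]; rewrite mul0r; lra.
have x2p : 0 < x2 by rewrite lt_neqAle eq_sym x2n.
rewrite -(ler_pM2l x2p); have := ler_wpM2l x0 hk; lra.
Qed.

Lemma Vcheck_ok (a a1 : Z) E e T l1 l2 : ZR R a = 32 * l2 -> ZR R a1 = 32 * l1 ->
  0 < l1 -> sound_table l2 E T -> (e <= E)%N -> (0 < e)%N -> e%:R < l1 * l1 ->
  Vcheck T a a1 e -> forall l, l1 <= l -> l <= l2 -> star_dominates l e.
Proof.
move=> la la1 l10 T_ok eE e0 el /allP hV l ll1 ll2 p stp gp sp pe.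
have [d [q [pE s0 edq din hs]]] := cons_of_sum stp sp pe e0.
subst p; have := hV d din; cbv beta zeta; rewrite edq sparseP //.
have l0 : 0 < l by lra.
have [stq gq] : strict q /\ good l q by case/andP: stp; case/andP: gp.
have [gq2 psi_le _] := psi_bilinear l0 ll2 stq gq.
set z := get _ _ _; set y := (_ - _)%ZZ.
set r := Z.div _ _; case/and3P=> /Z.ltb_spec0 zI /Z.ltb_spec0 y0 hp.
have dqE : (d + sumn q <= E)%N by rewrite (leq_trans _ eE) // -sp.
have ftq : fits d q by case: (q) stp => //= d' ? /andP[].
have hz := T_ok _ _ _ dqE stq gq2 erefl ftq zI.
have hr := ZR_divl R (33554432 * Z.of_nat (sumn q)) y0; rewrite -/r in hr.
have := cubic_check_ok la1 (ltW l10) hp ll1; rewrite !ZR_nat.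
apply: star_wins => //; first by rewrite (lt_le_trans el) // ler_pM //; lra.
have -> : ZR R (32 * a - r)%ZZ / 1024 = l2 - ZR R r / 1024.
  by rewrite ZRB ZRM la ZR_32; field.
have [x20 _ _] := good_psi_bounds (lt_le_trans l0 ll2) stq gq2.
have yR : 0 < ZR R y by rewrite -(ZR0 R) ZR_lt; apply/Z.ltb_spec0.
have hy : 16384 * psi l2 q <= ZR R y.
  by rewrite /y !ZRB !ZRM ZR_nat ZR_U ZR_512 la; move: hz; rewrite /tval -/z; clear; lra.
have hip := psi_increment l0 ll2 stq gq.
have c : ZR R 33554432 = 16384 * (2 * 1024) by rewrite !ZRE; clear; lra.
rewrite ZRM c ZR_nat in hr.
have r0 : 0 <= ZR R r.
  rewrite -(ZR0 R) ZR_le; apply/Z.leb_spec0; apply: Z.div_pos; last exact: y0.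
  by apply: Z.mul_nonneg_nonneg; last exact: Nat2Z.is_nonneg.
have [x0 _ _] := good_psi_bounds l0 stq gq.
have sR : 0 < (sumn q)%:R :> R by rewrite ltr0n.
apply: (secant_bound sR x0 x20 hip).
by apply: (@scaled_bound 16384 1024 _ _ (ZR R y)) => //; rewrite ?ltr0n.
Qed.

Lemma Vfinal_ok (a1 : Z) e l1 : ZR R a1 = 32 * l1 -> 0 < l1 -> (0 < e)%N ->
  e%:R < l1 * l1 -> Vfinal a1 e -> forall l, l1 <= l -> star_dominates l e.
Proof.
move=> la1 l10 e0 el /allP hV l ll1 p stp gp sp pe.
have [d [q [pE s0 edq din hs]]] := cons_of_sum stp sp pe e0.
subst p; have := hV d din; cbv beta zeta; rewrite edq sparseP // => hp.
have l0 : 0 < l by lra.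
have [stq gq] : strict q /\ good l q by case/andP: stp; case/andP: gp.
have := cubic_check_ok la1 (ltW l10) hp ll1; rewrite !ZR_nat.
apply: star_wins => //; first by rewrite (lt_le_trans el) // ler_pM //; lra.
have -> : ZR R (1024 * Z.of_nat (minn (sumn q) d.-1))%ZZ / 1024 = (minn (sumn q) d.-1)%:R.
  rewrite ZRM ZR_nat; have -> : ZR R 1024 = 1024 by rewrite !ZRE; clear; lra.
  by rewrite mulrAC divff ?mul1r // pnatr_eq0.
case: q stp gp sp s0 hs edq stq gq {hp pe} => // d' r stp gp sp s0 hs edq stq gq.
apply: le_trans (psi_head_le l0 stq gq).
have [x0 _ _] := good_psi_bounds l0 stq gq.
apply: ler_wpM2l => //; rewrite lerD2l lerN2 ler_nat leq_min leq_addr /=.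
by case/andP: stp => /= h _; case: (d) h.
Qed.

(** The last inequality excludes n < e + 2, where the star has no graph to realise it. It passes
    from l1 to larger l because the right side grows faster, as l1^2 >= 2 e and l1 >= 1. *)
Lemma Vstart_ok (a1 : Z) e l1 : ZR R a1 = 32 * l1 -> 0 < l1 -> (0 < e)%N ->
  Vstart a1 (Z.of_nat e) -> e%:R < l1 * l1 /\
  forall l, l1 <= l -> e%:R * (2 * l + e%:R + 1) <= (l * l - e%:R) * (l * l - e%:R).
Proof.
move=> la1 l10 e0 /andP[]; rewrite -(ZR_lt R) -(ZR_le R).
have [t tE] : exists t : R, t = 32 by exists 32.
have c1 : ZR R 1024 = t * t by rewrite tE !ZRE; clear; lra.
have c2 : ZR R 65536 = 2 * t * (t * t) by rewrite tE !ZRE; clear; lra.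
have c3 : ZR R 1048576 = t * t * (t * t) by rewrite tE !ZRE; clear; lra.
have t0 : 0 < t by rewrite tE.
rewrite !(ZRM, ZRB, ZRD) c1 c2 c3 ZR1 ZR_nat la1 -tE.
move: t0; clear c1 c2 c3 tE la1 => t0.
have : 1 <= e%:R :> R by rewrite ler1n.
move: (e%:R) => x x1 h1 h2.
have t2 : 0 < t * t by rewrite mulr_gt0.
have el : x < l1 * l1 by rewrite -(ltr_pM2l t2); lra.
split=> // l ll1.
have h2' : x * (2 * l1 + x + 1) <= (l1 * l1 - x) * (l1 * l1 - x).
  by rewrite -(ler_pM2l (mulr_gt0 t2 t2)); lra.
have l1x : x <= l1 * l1 - x.
  rewrite leNgt; apply/negP => hlt.
  have : (l1 * l1 - x) * (l1 * l1 - x) < x * x by rewrite ltr_pM //; lra.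
  have : 0 < x * (2 * l1 + 1) by apply: mulr_gt0; lra.
  lra.
have l1_1 : 1 <= l1.
  rewrite leNgt; apply/negP => hlt.
  have : l1 * l1 < 1 * 1 by apply: ltr_pM => //; exact: ltW.
  lra.
have [h lE] : exists h, l = l1 + h by exists (l - l1); lra.
have h0 : 0 <= h by lra.
have hY : l1 * l1 - x + 2 * l1 * h <= l * l - x by rewrite lE; nra.
have Y0 : 0 <= l1 * l1 - x + 2 * l1 * h by have := mulr_ge0 (ltW l10) h0; lra.
apply: (@le_trans _ _ ((l1 * l1 - x + 2 * l1 * h) * (l1 * l1 - x + 2 * l1 * h))); last first.
  by apply: ler_pM.
have t1 : 0 <= h * (2 * l1 * (l1 * l1 - x - x)) by apply: mulr_ge0 => //; apply: mulr_ge0; lra.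
have t5 : 0 <= h * (x * (l1 - 1)) by apply: mulr_ge0 => //; apply: mulr_ge0; lra.
have t3 : 0 <= h * h * (l1 * l1) by rewrite !mulr_ge0 // ltW.
have t4 : 0 <= h * x by apply: mulr_ge0; lra.
rewrite lE; lra.
Qed.
End Phases.

(** * Combining the intervals of l for one value of e *)

Section Dichotomy.
Variable R : realFieldType.
Variable Ts : tables.
(** An index out of range yields the default entry, whose E is 0; the checks demand e <= E with e
    positive, so they never accept it. *)
Hypothesis Ts_ok : forall j a E T, entry Ts j = (a, E, T) -> (0 < E)%N -> T = table a E.

Lemma ZR_point (a : Z) : exists l : R, ZR R a = 32 * l.
Proof. by exists (ZR R a / 32); field. Qed.

Lemma table_sound (a : Z) E (l : R) : ZR R a = 32 * l -> 0 < l -> Z.lt (scaledL a) INF ->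
  sound_table l E (table a E).
Proof.
move=> la l0 Msmall m s p; apply: table_ok => //.
have : 0 < ZR R a by rewrite la mulr_gt0.
by rewrite -(ZR0 R) ZR_lt => /Z.ltb_spec0.
Qed.

Lemma chain_ok e (a : Z) js (l1 : R) : (0 < e)%N -> ZR R a = 32 * l1 -> 0 < l1 ->
  e%:R < l1 * l1 -> chain Ts e a js -> forall l, l1 <= l -> star_dominates l e.
Proof.
move=> e0; elim: js a l1 => [|j js IH] a l1 la l10 el /=.
  by move=> hV l; apply: Vfinal_ok la l10 e0 el hV l.
case Ej: (entry Ts j) => [[a' E] T].
case/and5P=> eE /Z.leb_spec0 aa /Z.ltb_spec0 Msmall hV hc l ll1.
have [l2 la'] := ZR_point a'.
have l12 : l1 <= l2.
  have : ZR R a <= ZR R a' by rewrite ZR_le; apply/Z.leb_spec0.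
  by rewrite la la' ler_pM2l.
have l20 : 0 < l2 := lt_le_trans l10 l12.
have TE := Ts_ok Ej (leq_trans e0 eE); subst T.
have [ll2|/ltW ll2] := lerP l l2.
  by apply: (Vcheck_ok la' la l10 (table_sound la' l20 Msmall) eE e0 el hV).
apply: IH la' l20 _ hc _ ll2; apply: lt_le_trans el _.
by apply: ler_pM => //; exact: ltW.
Qed.

Definition dominates l D e := forall p, strict p -> good l p -> sumn p = e ->
  p != D -> p != [:: e] -> (psi l p : R) < psi l D.

Lemma route_ok e js : (0 < e)%N -> checkD Ts e js -> checkV Ts e js ->
  let k := clique_size e in let D := Dlist k (e - (k * k.-1)./2) in
  [/\ (k * k.-1 <= 2 * e < k.+1 * k)%N, strict D, sumn D = e &
   forall l, k%:R <= l -> (good l D /\ dominates l D e) \/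
     [/\ e%:R < l * l, e%:R * (2 * l + e%:R + 1) <= (l * l - e%:R) * (l * l - e%:R)
       & star_dominates l e]].
Proof.
move=> e0; rewrite /checkD /checkV; case: js => // j js.
case Ej: (entry Ts j) => [[a E] T].
case/and5P=> hk stD /eqP sD eE hD /andP[hs hc].
move: hk stD sD hD; set k := clique_size e; set D := Dlist _ _ => hk stD sD hD.
split=> // l kl.
have k0 : (0 < k)%N by move: hk; case: (k) => //; rewrite muln0 ltn0 andbF.
have TE := Ts_ok Ej (leq_trans e0 eE); subst T.
have [l1 la] := ZR_point a.
have [Msmall ka] : Z.lt (scaledL a) INF /\ Z.le (32 * Z.of_nat k) a.
  move: hD; rewrite /Dcheck; case: (psi_frac _ _) => n m.
  by case/and5P=> _ _ _ /Z.leb_spec0 h /andP[/Z.ltb_spec0 h' _].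
have kl1 : k%:R <= l1.
  have : ZR R (32 * Z.of_nat k) <= ZR R a by rewrite ZR_le; apply/Z.leb_spec0.
  by rewrite ZRM ZR_32 ZR_nat la ler_pM2l.
have l10 : 0 < l1 by rewrite (lt_le_trans _ kl1) // ltr0n.
have [ll1|/ltW ll1] := lerP l l1.
  left; exact: (Dcheck_ok la (table_sound la l10 Msmall) eE e0 k0 stD sD hD kl ll1).
have [el hl] := Vstart_ok la l10 e0 hs.
right; split; last exact: chain_ok el hc _ ll1.
- by apply: lt_le_trans el _; apply: ler_pM => //; exact: ltW.
- exact: hl.
Qed.
End Dichotomy.

Theorem partition_dichotomy (R : realFieldType) e : (4 <= e <= 130)%N ->
  let k := clique_size e in let D := Dlist k (e - (k * k.-1)./2) in
  [/\ (k * k.-1 <= 2 * e < k.+1 * k)%N, strict D, sumn D = e &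
   forall l : R, k%:R <= l -> (good l D /\ dominates l D e) \/
     [/\ e%:R < l * l, e%:R * (2 * l + e%:R + 1) <= (l * l - e%:R) * (l * l - e%:R)
       & star_dominates l e]].
Proof.
move=> /andP[e4 e130].
have := check_all_ok; rewrite /check_all; set Ts := map _ _ => /allP h.
have e_in : (e, nth [::] routes (e - 4)) \in zip (iota 4 127) routes.
  have e1 : (e - 4 < 127)%N by lia.
  have <- : nth (0%N, [::]) (zip (iota 4 127) routes) (e - 4) = (e, nth [::] routes (e - 4)).
    by rewrite nth_zip // nth_iota // subnKC.
  by rewrite mem_nth // size_zip size_iota.
have /andP[oD oV] := h _ e_in.
apply: route_ok (_ : (0 < e)%N) oD oV; last exact: leq_trans e4.
move=> j a E T; rewrite /Ts /entry.
have [jl|jl] := ltnP j (size points); last by rewrite nth_default ?size_map // => -[_ <-].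
by rewrite (nth_map (Z0, 0%N)) // => -[<- <- <-].
Qed.

(** * Threshold graphs and their eigenvectors *)

(* The threshold graph of [p]: vertex [i] is joined to the next [p_i] ones. *)
Definition padj (p : seq nat) (i j : nat) : bool :=
  (i != j) && (maxn i j <= minn i j + nth 0%N p (minn i j))%N.

Lemma padj_sym p i j : padj p i j = padj p j i.
Proof. by rewrite /padj eq_sym maxnC minnC. Qed.

Lemma padjxx p i : padj p i i = false.
Proof. by rewrite /padj eqxx. Qed.

Lemma padj_nil i j : padj [::] i j = false.
Proof. by rewrite /padj nth_nil addn0; apply/negbTE/negP => /andP[]; lia. Qed.

Lemma padjSS d q i j : padj (d :: q) i.+1 j.+1 = padj q i j.
Proof. by rewrite /padj eqSS maxnSS minnSS /= addSn ltnS. Qed.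

Lemma padj0S d q j : padj (d :: q) 0 j.+1 = (j < d)%N.
Proof. by rewrite /padj /= min0n max0n. Qed.

Lemma padjS0 d q i : padj (d :: q) i.+1 0 = (i < d)%N.
Proof. by rewrite padj_sym padj0S. Qed.

Lemma strict_nth p i : strict p -> (0 < nth 0%N p i)%N -> (i + nth 0%N p i <= head 0%N p)%N.
Proof.
elim: p i => [|d q IH] [|i] //= /andP[hd sq] /(IH _ sq); lia.
Qed.

Lemma padj_le p i j : strict p -> padj p i j -> (maxn i j <= head 0%N p)%N.
Proof.
move=> st /andP[ij h]; have hp : (0 < nth 0%N p (minn i j))%N by lia.
exact: leq_trans h (strict_nth st hp).
Qed.

Section Solve.
Variable R : realFieldType.
Implicit Types (x : nat -> R) (p q : seq nat).

Lemma fits_split d q N : fits N (d :: q) -> exists m, N = (d + m).+1.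
Proof. by move=> h; exists (N - d.+1)%N; rewrite -addSn subnKC. Qed.

Lemma fits_tail d q : strict (d :: q) -> fits d q.
Proof. by case: q => //= e r /andP[]. Qed.

Lemma padj_out d q i j : strict (d :: q) -> (d <= maxn i j)%N -> padj q i j = false.
Proof.
move=> /andP[hd st] h; apply: contraTF (leq_ltn_trans (leqnn _) hd) => /(padj_le st); lia.
Qed.

Lemma row_cons d q m x i : strict (d :: q) ->
  \sum_(0 <= j < (d + m).+1) (padj (d :: q) i j)%:R * x j =
  if i is i'.+1 then
    if (i' < d)%N then x 0%N + \sum_(0 <= j < d) (padj q i' j)%:R * x j.+1 else 0
  else \sum_(0 <= j < d) x j.+1.
Proof.
move=> st; rewrite big_nat_recl //.
case: i => [|i].
  rewrite padjxx mul0r add0r (big_cat_nat (n := d)) //= ?leq_addr //.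
  rewrite [X in _ + X]big1_seq ?addr0; last first.
    by move=> j; rewrite mem_index_iota => /andP[_ /andP[dj _]]; rewrite padj0S ltnNge dj mul0r.
  by apply: eq_big_nat => j /andP[_ jd]; rewrite padj0S jd mul1r.
rewrite padjS0; under eq_bigr do rewrite padjSS.
case: ltnP => id; last first.
  rewrite mul0r add0r big1 // => j _; rewrite (padj_out st) ?mul0r //.
  by rewrite leq_max id.
rewrite mul1r (big_cat_nat (n := d)) //= ?leq_addr //.
rewrite [X in _ + (_ + X)]big1_seq ?addr0 // => j; rewrite mem_index_iota => /andP[_ /andP[dj _]].
by rewrite (padj_out st) ?mul0r // leq_max dj orbT.
Qed.

Lemma sum_cons d m x :
  \sum_(0 <= j < (d + m).+1) x j =
  x 0%N + \sum_(0 <= j < d) x j.+1 + \sum_(d <= j < d + m) x j.+1.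
Proof. by rewrite big_nat_recl // (big_cat_nat (n := d)) //= ?leq_addr // addrA. Qed.

Variable l : R.
Hypothesis l0 : 0 < l.

Definition solves (k : R) N p x := forall i, (i < N)%N ->
  0 < x i /\ l * x i = k + \sum_(0 <= j < N) (padj p i j)%:R * x j.

(** Row 0 gives x_0 (l^2 - S) = k (l + S). Both x_0 and the right side are positive, so positivity
    of the solution forces the denominators of [psi] to be positive. The remaining rows form the
    system of the tail with constant k + x_0. *)
Lemma solves_psi p N k x : strict p -> fits N p -> 0 < k -> solves k N p x ->
  good l p /\ l * \sum_(0 <= j < N) x j = k * (N%:R + psi l p).
Proof.
elim: p N k x => [|d q IH] N k x st ft k0 sx.
  split=> //; rewrite addr0 mulr_sumr.
  have E : \sum_(0 <= i < N) l * x i = \sum_(0 <= i < N) k.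
    apply: eq_big_nat => i /andP[_ iN]; have [_ ->] := sx i iN.
    by rewrite big1 ?addr0 // => j _; rewrite padj_nil mul0r.
  by rewrite E sumr_const_nat subn0 mulr_natr.
have [m NE] := fits_split ft; subst N.
have [x0 r0] := sx 0%N isT; rewrite row_cons // in r0.
have sq : strict q by case/andP: st.
have sx' : solves (k + x 0%N) d q (fun i => x i.+1).
  move=> i id; have iN : (i.+1 < (d + m).+1)%N by rewrite ltnS ltn_addr.
  have [xi ri] := sx _ iN; rewrite row_cons // id in ri.
  by split=> //; rewrite ri addrA.
have kx : 0 < k + x 0%N by rewrite addr_gt0.
have [gq E] := IH d _ _ sq (fits_tail st) kx sx'.
set S := d%:R + psi l q in E *.
set s := \sum_(0 <= j < d) _ in r0 E.
have e0 : x 0%N * (l * l - S) = k * (l + S).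
  have : l * (l * x 0%N) = l * k + (k + x 0%N) * S by rewrite r0 mulrDr E.
  lra.
have d1 : 0 < d%:R :> R by case/andP: st => hd _; rewrite ltr0n (leq_ltn_trans _ hd).
have [psi0 _ _] := good_psi_bounds l0 sq gq.
have S0 : 0 < S by rewrite ltr_pwDl.
have D0 : 0 < l * l - S.
  by rewrite -(pmulr_rgt0 _ x0) e0 mulr_gt0 // addr_gt0.
have hg : l + d%:R + psi l q < l * (l + 1) by move: D0; rewrite /S; lra.
split; first by rewrite /= hg.
rewrite sum_cons [LHS]mulrDr [X in X + _ = _]mulrDr -/s E mulr_sumr.
have -> : \sum_(d <= i < d + m) l * x i.+1 = k * m%:R.
  transitivity (\sum_(d <= i < d + m) k); last by rewrite sumr_const_nat addKn mulr_natr.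
  apply: eq_big_nat => i /andP[di iN]; have iN' : (i.+1 < (d + m).+1)%N by [].
  by have [_ ->] := sx _ iN'; rewrite row_cons // ltnNge di addr0.
have x0E : x 0%N = k * (l + S) / (l * l - S) by rewrite -e0 mulfK // gt_eqF.
have -> : psi l (d :: q) = l * (l + 1) * (l + S) / (l * (l + 1) - (l + S)) - l - d.+1%:R.
  by rewrite /= -[l + d%:R + _]addrA.
rewrite x0E -[(d + m).+1]addn1 -[d.+1]addn1 !natrD.
have n1 : l * l - S != 0 by rewrite gt_eqF.
have -> : l * (l + 1) - (l + S) = l * l - S by ring.
clearbody S; by field.
Qed.

Lemma solves_exists p N : strict p -> fits N p -> good l p -> exists x, solves 1 N p x.
Proof.
elim: p N => [|d q IH] N st ft gp.
  exists (fun=> l^-1) => i iN; rewrite invr_gt0; split=> //.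
  by rewrite big1 ?addr0 ?divff ?gt_eqF // => j _; rewrite padj_nil mul0r.
have [m NE] := fits_split ft; subst N.
have [hg gq] : l + d%:R + psi l q < l * (l + 1) /\ good l q by case/andP: gp.
have sq : strict q by case/andP: st.
have [y sy] := IH d sq (fits_tail st) gq.
have [_ E] := solves_psi sq (fits_tail st) ltr01 sy.
rewrite mul1r in E; set S := d%:R + psi l q in E.
have [psi0 _ _] := good_psi_bounds l0 sq gq.
have S0 : 0 <= S by rewrite addr_ge0.
have D0 : 0 < l * l - S by rewrite /S; lra.
set x0 := (l + S) / (l * l - S).
have x0p : 0 < x0 by rewrite divr_gt0 // ltr_pwDl.
(* The dominating vertex raises the constant of the tail from 1 to 1 + x0, so its solution scales by
   this factor; isolated vertices only satisfy l x = 1. *)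
pose x i := if i is i'.+1 then if (i' < d)%N then (1 + x0) * y i' else l^-1 else x0.
exists x => i iN; rewrite row_cons //.
case: i iN => [|i] iN.
  split=> //; under eq_big_nat => j /andP[_ jd] do rewrite /= jd.
  rewrite -mulr_sumr; apply: (mulfI (lt0r_neq0 l0)).
  rewrite mulrDr [X in _ = _ + X]mulrCA E /= /x0.
  by field; rewrite gt_eqF.
rewrite /=; case: ltnP => id; last by rewrite invr_gt0 addr0 divff ?gt_eqF.
have [yi ry] := sy i id; split; first by rewrite mulr_gt0 // addr_gt0.
under eq_big_nat => j /andP[_ jd] do rewrite /= jd mulrCA.
by rewrite -mulr_sumr mulrCA ry; ring.
Qed.
End Solve.

(** * The spectral radius *)

Section Spectral.
Local Open Scope sesquilinear_scope.

(* The equality case of Rayleigh's principle for the largest eigenvalue. *)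
Lemma hermitian_rayleigh (C : numClosedFieldType) n (A : 'M[C]_n) (r : C) (v : 'rV[C]_n) :
  A \is hermsymmx -> (forall z, eigenvalue A z -> `|z| <= r) ->
  r * (v *m v ^t*) 0 0 <= (v *m A *m v ^t*) 0 0 -> v *m A = r *: v.
Proof.
move=> Ah hA hv.
have /orthomx_spectralP := hermitian_normalmx Ah.
have PU := spectral_unitarymx A; have Dreal := hermitian_spectral_diag_real Ah.
move: PU Dreal; set P := spectralmx A; set D := spectral_diag A => PU Dreal AE.
rewrite invmx_unitary // in AE.
have PtP : P ^t* *m P = 1%:M by rewrite -invmx_unitary // mulVmx // unitarymx_unit.
pose w := v *m P ^t*.
have vE : v = w *m P by rewrite /w -mulmxA PtP mulmx1.
have vtE : v ^t* = P ^t* *m w ^t* by rewrite {1}vE trmx_mul map_mxM.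
have PPt := unitarymxP PU.
have vv : (v *m v ^t*) 0 0 = \sum_i `|w 0 i| ^+ 2.
  rewrite {1}vE vtE !mulmxA -[w *m P *m _]mulmxA PPt mulmx1 mxE.
  by apply: eq_bigr => i _; rewrite !mxE normCK.
have vA : v *m A = w *m diag_mx D *m P by rewrite AE /w !mulmxA.
have vAv : (v *m A *m v ^t*) 0 0 = \sum_i D 0 i * `|w 0 i| ^+ 2.
  rewrite vA vtE !mulmxA -[_ *m P *m _]mulmxA PPt mulmx1 mxE.
  apply: eq_bigr => i _; rewrite mul_mx_diag !mxE normCK; ring.
have Dr i : D 0 i <= r.
  apply: le_trans (real_ler_norm (mxOverP Dreal 0 i)) (hA _ _).
  apply/eigenvalueP; exists (row i P).
    rewrite AE -row_mul !mulmxA PPt mul1mx.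
    by apply/rowP => j; rewrite mul_diag_mx !mxE.
  apply/eqP => Pi0; have /rowP/(_ i) : row i P *m P ^t* = row i 1%:M by rewrite -row_mul PPt.
  by rewrite Pi0 mul0mx !mxE eqxx => /esym/eqP; rewrite oner_eq0.
have z0 : \sum_i (r - D 0 i) * `|w 0 i| ^+ 2 = 0.
  apply/le_anti/andP; split; last first.
    by apply: sumr_ge0 => i _; rewrite mulr_ge0 ?subr_ge0 ?exprn_ge0.
  under eq_bigr do rewrite mulrBl.
  by rewrite sumrB -mulr_sumr -vv -vAv subr_le0.
have zi i : (r - D 0 i) * w 0 i = 0.
  have : (r - D 0 i) * `|w 0 i| ^+ 2 == 0.
    move/eqP: z0; rewrite psumr_eq0 => [/allP/(_ i)|j _]; first by rewrite mem_index_enum => /(_ isT).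
    by rewrite mulr_ge0 ?subr_ge0 ?exprn_ge0.
  by rewrite mulf_eq0 expf_eq0 /= normr_eq0 => /orP[] /eqP ->; rewrite ?mul0r ?mulr0.
rewrite vA [in RHS]vE scalemxAl; congr (_ *m _).
apply/rowP => i; rewrite mul_mx_diag mxE [RHS]mxE.
by move/eqP: (zi i); rewrite mulrBl subr_eq0 [w 0 i * _]mulrC eq_sym => /eqP.
Qed.

End Spectral.

Section Radius.
Local Open Scope sesquilinear_scope.
Variables (R : realType) (G : sgraph).
Implicit Types (x y : G -> R).

Definition adjsum y u : R := \sum_v (adj u v)%:R * y v.

Lemma sum_enum_val (F : G -> R) : \sum_(i < #|G|) F (enum_val i) = \sum_u F u.
Proof. by rewrite [RHS](reindex (@enum_val G G)) //; exact: onW_bij (enum_val_bij G). Qed.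

Lemma normc_ge0 (z : R[i]) : 0 <= Normc.normc z.
Proof. by case: z => a b; rewrite sqrtr_ge0. Qed.

(** Here l is only an upper bound of the radius, so the lemma applies to a graph other than the one
    defining l, and to proofs by contradiction. *)
Lemma rayleigh_eq (l : R) y : (0 < #|G|)%N -> spectral_radius R G <= l ->
  l * \sum_u y u ^+ 2 <= \sum_u y u * adjsum y u -> forall u, adjsum y u = l * y u.
Proof.
move=> G0 hl hy; have [_ hmax] := spectral_radiusP R G0.
set A := adj_mx R[i] G in hmax.
pose v : 'rV[R[i]]_#|G| := \row_i (y (enum_val i))%:C%C.
have AE i j : A i j = ((adj (enum_val i) (enum_val j))%:R : R)%:C%C.
  by rewrite mxE rmorph_nat.
have Asym : A \is symmetricmx.
  apply/is_hermitianmxP; rewrite scale1r map_mx_id //.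
  by apply/matrixP => i j; rewrite !mxE adj_sym.
have Areal : A \is a realmx.
  by apply/mxOverP => i j; rewrite mxE realn.
have vt : v ^t* = v^T.
  by apply/matrixP => i j; rewrite !mxE; exact: conjc_real.
have vAE j : (v *m A) 0 j = (adjsum y (enum_val j))%:C%C.
  rewrite mxE /adjsum -sum_enum_val rmorph_sum; apply: eq_bigr => i _.
  by rewrite AE mxE -rmorphM adj_sym mulrC.
have hv : v *m A = (l%:C)%C *: v.
  apply: hermitian_rayleigh; first exact: realsym_hermsym.
    by move=> z /hmax hz; rewrite -[`|z|]/((Normc.normc z)%:C)%C lecR (le_trans hz).
  rewrite vt.
  have -> : (v *m v^T) 0 0 = (\sum_u y u ^+ 2)%:C%C.
    rewrite mxE -sum_enum_val rmorph_sum; apply: eq_bigr => i _.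
    by rewrite !mxE expr2 rmorphM.
  have -> : (v *m A *m v^T) 0 0 = (\sum_u y u * adjsum y u)%:C%C.
    rewrite mxE -sum_enum_val rmorph_sum; apply: eq_bigr => i _.
    by rewrite vAE !mxE rmorphM mulrC.
  by rewrite -rmorphM lecR.
move=> u; have /rowP/(_ (enum_rank u)) := hv.
by rewrite vAE !mxE enum_rankK -rmorphM => /complexI.
Qed.

(** Take the moduli of an eigenvector whose eigenvalue has the largest modulus. The triangle
    inequality gives l x <= A x entrywise, and the equality case of Rayleigh's principle makes x an
    eigenvector. *)
Lemma perron_vector : (0 < #|G|)%N -> exists x,
  [/\ forall u, 0 <= x u, exists u, 0 < x u & forall u, adjsum x u = spectral_radius R G * x u].
Proof.
move=> G0; have [[z /eigenvalueP[w wA w0] zE] _] := spectral_radiusP R G0.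
set l := spectral_radius R G in zE *.
pose x u := Normc.normc (w 0 (enum_rank u)).
have x0 u : 0 <= x u by exact: normc_ge0.
exists x; split=> //.
  have /rV0Pn[i wi] := w0; exists (enum_val i); rewrite lt_neqAle x0 andbT eq_sym.
  by apply: contra wi; rewrite /x enum_valK => /eqP/Normc.eq0_normc ->.
apply: rayleigh_eq => //; rewrite mulr_sumr; apply: ler_sum => u _.
rewrite expr2 mulrCA; apply: ler_wpM2l => //.
have /rowP/(_ (enum_rank u)) := wA; rewrite !mxE => /(congr1 (@Normc.normc R)).
rewrite Normc.normcM -zE -/(x u) => <-.
have normc_sum (I : Type) (r : seq I) (F : I -> R[i]) :
    Normc.normc (\sum_(i <- r) F i) <= \sum_(i <- r) Normc.normc (F i).
  elim: r => [|a r IH]; first by rewrite !big_nil Normc.normc0.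
  by rewrite !big_cons (le_trans (le_normcD _ _)) // lerD2l.
apply: le_trans (normc_sum _ _ _) _.
rewrite /adjsum -(sum_enum_val (fun v => _ * x v)); apply: ler_sum => i _.
rewrite Normc.normcM mxE mulrC /x enum_valK enum_rankK adj_sym.
by case: (adj _ _); rewrite ?Normc.normc1 ?Normc.normc0.
Qed.
End Radius.

(** * Graphs with a ranking *)

Definition ranking (G : sgraph) (p : seq nat) (r : G -> nat) : Prop :=
  [/\ injective r, forall u, (r u < #|G|)%N & forall u v, adj u v = padj p (r u) (r v)].

Lemma ranking_inv (G : sgraph) p (r : G -> nat) : ranking p r ->
  exists2 g : 'I_#|G| -> G, bijective g & forall i, r (g i) = i.
Proof.
move=> [ir br _]; pose f u : 'I_#|G| := Ordinal (br u).
have f_inj : injective f by move=> a b /(congr1 val) /= /ir.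
have [g fK gK] : bijective f by apply: inj_card_bij => //; rewrite card_ord.
by exists g => [|i]; [exists f | rewrite -[r _]/(val (f _)) gK].
Qed.

Lemma giso_of_ranking (G H : sgraph) p (rG : G -> nat) (rH : H -> nat) : #|G| = #|H| ->
  ranking p rG -> ranking p rH -> giso G H.
Proof.
move=> GH [iG bG aG] rkH; have [gH _ gHE] := ranking_inv rkH.
pose f u := gH (cast_ord GH (Ordinal (bG u))).
have fE u : rH (f u) = rG u by rewrite gHE.
exists f; split; last by move=> x y; case: rkH => _ _ ->; rewrite aG !fE.
apply: inj_card_bij; last by rewrite GH.
by move=> a b /(congr1 rH); rewrite !fE => /iG.
Qed.

Lemma card_edges (G : sgraph) : (2 * #|edges G| = #|[set q : G * G | adj q.1 q.2]|)%N.
Proof.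
pose L := [set q : G * G | adj q.1 q.2 && (enum_rank q.1 < enum_rank q.2)%N].
pose M := [set q : G * G | adj q.1 q.2 && (enum_rank q.2 < enum_rank q.1)%N].
have neq a b : adj a b -> (a : G) != b by apply: contraTneq => ->; rewrite adj_irr.
have cLM : #|L| = #|M|.
  pose sw (q : G * G) := (q.2, q.1); have swK : involutive sw by case.
  rewrite -(card_imset _ (inv_inj swK)); apply: eq_card => -[a b].
  rewrite inE /=; apply/imsetP/idP => [[[c d]]|h]; last first.
    by exists (b, a); rewrite // inE /= adj_sym.
  by rewrite inE /= adj_sym => h [-> ->].
have -> : #|[set q : G * G | adj q.1 q.2]| = (#|L| + #|M|)%N.
  rewrite -cardsUI [L :&: M](_ : _ = set0) ?cards0 ?addn0; last first.
    by apply/setP => -[a b]; rewrite !inE /=; apply/negbTE/negP => /andP[/andP[_ h] /andP[_]]; lia.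
  apply: eq_card => -[a b]; rewrite !inE /= -andb_orr -neq_ltn.
  case ab: (adj a b) => //=; apply/esym.
  by apply: contra (neq _ _ ab) => /eqP/val_inj/enum_rank_inj ->.
have -> : edges G = [set [set q.1; q.2] | q in L].
  apply/setP => A; apply/imsetP/imsetP => -[[a b]]; rewrite !inE /=; last first.
    by move=> /andP[ab _] ->; exists (a, b); rewrite ?inE.
  move=> ab ->; have := neq _ _ ab; rewrite -(inj_eq enum_rank_inj) -val_eqE /= neq_ltn => /orP[h|h].
    by exists (a, b); rewrite ?inE /= ?ab.
  by exists (b, a); rewrite ?inE /= ?(adj_sym b) ?ab // setUC.
rewrite card_in_imset -?cLM ?addnn ?mul2n // => -[a b] [c d]; rewrite !inE /=.
move=> /andP[_ h1] /andP[_ h2] E.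
have : a \in [set c; d] by rewrite -E !inE eqxx.
have : b \in [set c; d] by rewrite -E !inE eqxx orbT.
rewrite !inE => /orP[]/eqP bE /orP[]/eqP aE; subst a b => //; move: h1 h2; lia.
Qed.

Section Sums.
Variable R : realFieldType.

Lemma card_adj (G : sgraph) :
  (#|[set q : G * G | adj q.1 q.2]|)%:R = \sum_u \sum_v (adj (u : G) v)%:R :> R.
Proof.
rewrite pair_big /= -sum1_card natr_sum big_mkcond.
by apply: eq_bigr => -[a b] _; rewrite inE /=; case: adj.
Qed.

Lemma sum_ranking (G : sgraph) p r (F : nat -> R) : ranking (G := G) p r ->
  \sum_u F (r u) = \sum_(0 <= i < #|G|) F i.
Proof.
move=> /ranking_inv[g g_bij gE]; rewrite big_mkord (reindex g) /=; last exact: onW_bij.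
by apply: eq_bigr => i _; rewrite gE.
Qed.

Lemma sum_padj p N : strict p -> fits N p ->
  \sum_(0 <= i < N) \sum_(0 <= j < N) (padj p i j)%:R = 2 * (sumn p)%:R :> R.
Proof.
elim: p N => [|d q IH] N st ft.
  by rewrite /= mulr0 big1 // => i _; rewrite big1 // => j _; rewrite padj_nil.
have [m NE] := fits_split ft; subst N.
have rE i : \sum_(0 <= j < (d + m).+1) (padj (d :: q) i j)%:R =
    \sum_(0 <= j < (d + m).+1) (padj (d :: q) i j)%:R * 1 :> R.
  by apply: eq_bigr => j _; rewrite mulr1.
under eq_bigr do rewrite rE (row_cons m (fun=> 1) _ st).
rewrite sum_cons sumr_const_nat subn0.
rewrite [X in _ + X]big1_seq ?addr0; last first.
  by move=> i; rewrite mem_index_iota => /andP[_ /andP[di _]]; rewrite /= ltnNge di.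
have -> : \sum_(0 <= i < d) (if (i < d)%N then 1 + \sum_(0 <= j < d) (padj q i j)%:R * 1 else 0) =
    \sum_(0 <= i < d) (1 + \sum_(0 <= j < d) (padj q i j)%:R) :> R.
  apply: eq_big_nat => i /andP[_ ->]; congr (_ + _).
  by apply: eq_bigr => j _; rewrite mulr1.
rewrite big_split /= sumr_const_nat subn0 IH ?(fits_tail st) //; last by case/andP: st.
by rewrite natrD; ring.
Qed.
End Sums.

Lemma edges_ranking (G : sgraph) p r : strict p -> fits #|G| p -> ranking (G := G) p r ->
  #|edges G| = sumn p.
Proof.
move=> st ft rk; have [_ _ aG] := rk.
have h : (2 * #|edges G|)%:R = (2 * sumn p)%:R :> rat.
  rewrite card_edges card_adj natrM -(sum_padj _ st ft).
  rewrite -(sum_ranking (fun i => \sum_(0 <= j < _) (padj p i j)%:R) rk).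
  apply: eq_bigr => u _; rewrite -(sum_ranking (fun j => (padj p (r u) j)%:R) rk).
  by apply: eq_bigr => v _; rewrite aG.
by move/eqP: h; rewrite eqr_nat eqn_mul2l => /eqP.
Qed.

Lemma in_C_ranking (G : sgraph) q r n e : #|G| = n -> (0 < n)%N -> strict (n.-1 :: q) ->
  ranking (G := G) (n.-1 :: q) r -> sumn q = e -> in_C n e G.
Proof.
move=> Gn n0 st rk sq; have [ir br aG] := rk; have [g _ gE] := ranking_inv rk.
split=> //; last first.
  have ft : fits #|G| (n.-1 :: q) by rewrite /fits Gn prednK.
  by rewrite (edges_ranking st ft rk) -sq subn1.
split; first by rewrite Gn.
have Gp : (0 < #|G|)%N by rewrite Gn.
pose z := g (Ordinal Gp); have rz : r z = 0%N by exact: gE.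
have az u : u != z -> adj z u.
  rewrite -(inj_eq ir) rz aG rz => ru.
  have [m E] : exists m, r u = m.+1 by exists (r u).-1; rewrite prednK // lt0n.
  by rewrite E padj0S -ltnS -E prednK // -Gn.
have cz u : connect (@adj G) z u.
  by have [->|/az h] := eqVneq u z; [exact: connect0|exact: connect1].
have sym : connect_sym (@adj G) by apply: sym_connect_sym; exact: adj_sym.
by move=> u v; apply: connect_trans (cz v); rewrite sym.
Qed.

Section Compare.
Variable R : realType.
Implicit Types G : sgraph.

Lemma adjsum_ranking G p (r : G -> nat) (x : nat -> R) u : ranking p r ->
  adjsum (x \o r) u = \sum_(0 <= j < #|G|) (padj p (r u) j)%:R * x j.
Proof.
move=> rk; have [_ _ aG] := rk.
rewrite -(sum_ranking (fun j => (padj p (r u) j)%:R * x j) rk).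
by apply: eq_bigr => v _; rewrite aG.
Qed.

Lemma ranking_ex G p (r : G -> nat) i : ranking p r -> (i < #|G|)%N -> exists u, r u = i.
Proof.
by move=> /ranking_inv[g _ gE] iG; exists (g (Ordinal iG)).
Qed.

(* Otherwise the vector equal to 1 at the dominating vertex and solving the other rows of
   A x = l x would be an eigenvector for l by the equality case. *)
Lemma radius_gt G n q (r : G -> nat) (l : R) : #|G| = n -> (0 < n)%N -> 0 < l ->
  strict (n.-1 :: q) -> ranking (n.-1 :: q) r -> good l q ->
  l * l < n.-1%:R + psi l q -> l < spectral_radius R G.
Proof.
move=> <- {n} G0 l0 st rk gq hl; rewrite ltNge; apply/negP => hle.
set N := #|G|.-1 in st rk hl.
have GN : #|G| = (N + 0).+1 by rewrite addn0 prednK.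
have sq : strict q by case/andP: st.
have [y sy] := solves_exists l0 sq (fits_tail st) gq.
have [_ sumy] := solves_psi l0 sq (fits_tail st) ltr01 sy; rewrite mul1r in sumy.
pose x i := if i is i'.+1 then y i' else 1.
have x0 u : 0 < x (r u).
  have [_ br _] := rk; have := br u; rewrite GN addn0.
  by case: (r u) => [|i] //= iN; case: (sy i iN).
have rowE u : adjsum (x \o r) u =
    if r u is 0 then l^-1 * (N%:R + psi l q) else l * x (r u).
  rewrite (adjsum_ranking _ _ rk) GN row_cons //.
  have := rk => -[_ /(_ u) + _]; rewrite GN addn0.
  case: (r u) => [|i] iN; first by rewrite -sumy mulrA mulVf ?mul1r // gt_eqF.
  by have iN' : (i < N)%N by [] ; rewrite iN' /=; case: (sy i iN') => _ ->.
have row_ge u : l * x (r u) <= adjsum (x \o r) u.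
  rewrite rowE; case: (r u) => //=; rewrite mulr1 mulrC ler_pdivlMr //.
  exact: ltW.
have h : l * \sum_u (x \o r) u ^+ 2 <= \sum_u (x \o r) u * adjsum (x \o r) u.
  rewrite mulr_sumr; apply: ler_sum => u _.
  by rewrite expr2 mulrCA; apply: ler_wpM2l; [exact: (ltW (x0 u))|exact: row_ge].
have [z rz] := ranking_ex rk G0.
have := rayleigh_eq G0 hle h z; rewrite rowE rz /= rz /= mulr1 => E.
by move: hl; rewrite -[X in _ < X](mulVKf (lt0r_neq0 l0)) E ltxx.
Qed.

(** The indicator of the clique has quadratic form at least k (k + 1). If the radius m were below k,
    the equality case would make it an eigenvector for m, with form m (k + 1). *)
Lemma radius_clique G p (r : G -> nat) k : ranking p r -> (k < #|G|)%N ->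
  (forall i j, (i < j)%N -> (j <= k)%N -> padj p i j) -> k%:R <= spectral_radius R G.
Proof.
move=> rk kG cl; rewrite leNgt; apply/negP => hlt.
have G0 : (0 < #|G|)%N by exact: leq_ltn_trans kG.
pose x i : R := (i <= k)%N%:R.
have sumk (F : nat -> R) : \sum_(0 <= i < #|G|) x i * F i = \sum_(0 <= i < k.+1) F i.
  rewrite (big_cat_nat (n := k.+1)) //= [X in _ + X]big1_seq ?addr0; last first.
    by move=> i; rewrite mem_index_iota => /andP[_ /andP[h _]]; rewrite /x leqNgt h mul0r.
  by apply: eq_big_nat => i /andP[_ h]; rewrite /x -ltnS h mul1r.
have row u : (r u <= k)%N -> k%:R <= adjsum (x \o r) u.
  move=> uk; rewrite (adjsum_ranking _ _ rk).
  under eq_bigr do rewrite mulrC; rewrite sumk.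
  rewrite (bigD1_seq (r u)) ?iota_uniq ?mem_index_iota //= padjxx add0r.
  have -> : k%:R = \sum_(0 <= i < k.+1 | i != r u) 1 :> R.
    have : \sum_(0 <= i < k.+1) (1 : R) = 1 + \sum_(0 <= i < k.+1 | i != r u) 1.
      by rewrite (bigD1_seq (r u)) ?iota_uniq ?mem_index_iota.
    by rewrite sumr_const_nat subn0 -[k.+1]addn1 natrD addrC => /addrI.
  rewrite big_seq_cond [leRHS]big_seq_cond; apply: ler_sum => i.
  rewrite mem_index_iota => /andP[/andP[_ ik] ir].
  have [h|h|h] := ltngtP i (r u); last by rewrite h eqxx in ir.
    by rewrite padj_sym cl.
  by rewrite cl.
have E : \sum_u (x \o r) u ^+ 2 = k.+1%:R.
  rewrite (sum_ranking (fun i => x i ^+ 2) rk).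
  under eq_bigr do rewrite expr2; rewrite sumk.
  under eq_bigr do rewrite -[x _]mulr1.
  have <- : \sum_(0 <= i < k.+1) (1 : R) = k.+1%:R by rewrite sumr_const_nat subn0.
  by apply: eq_big_nat => i /andP[_ h]; rewrite /x -ltnS h mulr1.
have h : k%:R * \sum_u (x \o r) u ^+ 2 <= \sum_u (x \o r) u * adjsum (x \o r) u.
  rewrite mulr_sumr; apply: ler_sum => u _ /=; rewrite /x.
  case: leqP => uk; rewrite ?mul0r ?expr0n ?mulr0 //= expr1n mulr1 mul1r.
  exact: row.
set m := spectral_radius R G in hlt.
have hm : m * \sum_u (x \o r) u ^+ 2 <= \sum_u (x \o r) u * adjsum (x \o r) u.
  by apply: le_trans h; rewrite ler_wpM2r ?(ltW hlt) // E.
have hE := rayleigh_eq G0 (lexx _) hm.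
move: h; under [leRHS]eq_bigr do rewrite hE mulrCA -expr2.
by rewrite -mulr_sumr E ler_pM2r ?ltr0n // leNgt hlt.
Qed.
End Compare.

(** * Structure of the maximisers *)

Section Rotation.
Variables (G : sgraph) (v w u : G).

Definition same_pair (a b c d : G) : bool := ((a == c) && (b == d)) || ((a == d) && (b == c)).

Definition rot_rel : rel G := fun a b =>
  (adj a b && ~~ same_pair a b v w) || (same_pair a b u w && (u != w)).

Lemma same_pair_sym a b c d : same_pair a b c d = same_pair b a c d.
Proof. by rewrite /same_pair orbC [(b == c) && _]andbC [(b == d) && _]andbC. Qed.

Lemma rot_sym : symmetric rot_rel.
Proof. by move=> a b; rewrite /rot_rel adj_sym ![same_pair a b _ _]same_pair_sym. Qed.

Lemma rot_irr : irreflexive rot_rel.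
Proof.
move=> a; rewrite /rot_rel adj_irr /= /same_pair.
by case: (eqVneq a u) => [->|] //=; case: (eqVneq u w); rewrite ?andbF ?orbF.
Qed.

(* the edge [v w] is rotated to [u w] *)
Definition rotation : sgraph := SGraph rot_sym rot_irr.

Hypotheses (vw : adj v w) (nuw : ~~ adj u w) (uw : u != w).

Lemma vw_neq : v != w. Proof. by apply: contraTneq vw => ->; rewrite adj_irr. Qed.
Lemma uv_neq : u != v. Proof. by apply: contraNneq nuw => ->. Qed.

Section Ring.
Variable R : realFieldType.

Lemma rot_relE a b : (rot_rel a b)%:R =
  (adj a b)%:R - (same_pair a b v w)%:R + (same_pair a b u w)%:R :> R.
Proof.
rewrite /rot_rel uw andbT.
have h1 : same_pair a b v w -> adj a b.
  by move=> /orP[] /andP[/eqP-> /eqP->] //; rewrite adj_sym.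
have h2 : same_pair a b u w -> ~~ adj a b.
  by move=> /orP[] /andP[/eqP-> /eqP->] //; rewrite adj_sym.
case E1: (same_pair a b v w) h1 => h1; case E2: (same_pair a b u w) h2 => h2.
- by move: (h2 isT); rewrite h1.
- by rewrite h1 //=; lra.
- by rewrite (negPf (h2 isT)) /=; lra.
- by rewrite /= orbF andbT; lra.
Qed.

Lemma sum_same_pair (c d : G) (F : G -> G -> R) : c != d ->
  \sum_a \sum_b (same_pair a b c d)%:R * F a b = F c d + F d c.
Proof.
move=> cd.
have E a b : (same_pair a b c d)%:R * F a b =
    (if a == c then if b == d then F a b else 0 else 0) +
    (if a == d then if b == c then F a b else 0 else 0).
  rewrite /same_pair; case: (eqVneq a c) => [->|ac] /=.
    rewrite (negPf cd) /= orbF addr0; by case: eqP; rewrite ?mul1r ?mul0r.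
  by rewrite add0r; case: (a == d); case: (b == c); rewrite ?mul1r ?mul0r.
under eq_bigr do (under eq_bigr do rewrite E; rewrite big_split).
rewrite big_split /=; congr (_ + _).
  rewrite (bigD1 c) //= [X in _ + X]big1 ?addr0 => [|a /negPf ->]; last by rewrite big1.
  rewrite eqxx (bigD1 d) //= [X in _ + X]big1 ?addr0 ?eqxx // => b /negPf ->; by [].
rewrite (bigD1 d) //= [X in _ + X]big1 ?addr0 => [|a /negPf ->]; last by rewrite big1.
rewrite eqxx (bigD1 c) //= [X in _ + X]big1 ?addr0 ?eqxx // => b /negPf ->; by [].
Qed.

Lemma rot_form (x : G -> R) :
  \sum_a \sum_b (rot_rel a b)%:R * (x a * x b) =
  \sum_a \sum_b (adj a b)%:R * (x a * x b) + 2 * (x w * (x u - x v)).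
Proof.
under eq_bigr do (under eq_bigr do rewrite rot_relE mulrDl mulrBl; rewrite big_split sumrB).
rewrite big_split sumrB /= (sum_same_pair (fun a b => x a * x b)) ?vw_neq //.
by rewrite (sum_same_pair (fun a b => x a * x b)) //; ring.
Qed.

Lemma rot_row_u (x : G -> R) :
  \sum_b (rot_rel u b)%:R * x b = \sum_b (adj u b)%:R * x b + x w.
Proof.
have E b : (rot_rel u b)%:R * x b = (adj u b)%:R * x b + (if b == w then x b else 0).
  rewrite rot_relE /same_pair !eqxx (negPf uw) (negPf uv_neq) /= subr0 orbF.
  by rewrite mulrDl; congr (_ + _); case: eqP => _; rewrite ?mul1r ?mul0r.
under eq_bigr do rewrite E; rewrite big_split /=; congr (_ + _).
by rewrite -big_mkcond big_pred1_eq.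
Qed.
End Ring.

Lemma rot_edges : #|edges rotation| = #|edges G|.
Proof.
have h : (2 * #|edges rotation|)%:R = (2 * #|edges G|)%:R :> rat.
  rewrite !card_edges !card_adj.
  have := rot_form (fun=> (1 : rat)); rewrite subrr !mulr0 addr0 => h.
  transitivity (\sum_(a : G) \sum_(b : G) (rot_rel a b)%:R * (1 * 1) : rat).
    by apply: eq_bigr => a _; apply: eq_bigr => b _; rewrite !mulr1.
  by rewrite h; apply: eq_bigr => a _; apply: eq_bigr => b _; rewrite !mulr1.
by move/eqP: h; rewrite eqr_nat eqn_mul2l => /eqP.
Qed.

(** The path v z w replaces the lost edge. *)
Lemma rot_connected z : connected_graph G -> rot_rel v z -> rot_rel z w ->
  connected_graph rotation.
Proof.
move=> [G0 cG] vz zw; split=> // a b.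
have vcw : connect rot_rel v w by apply: connect_trans (connect1 vz) (connect1 zw).
have sym : connect_sym rot_rel by apply: sym_connect_sym; exact: rot_sym.
have sub : subrel (@adj G) (connect rot_rel).
  move=> c d cd; case E: (same_pair c d v w).
    by case/orP: E => /andP[/eqP-> /eqP->] //; rewrite sym.
  by apply: connect1; rewrite /rot_rel cd E.
exact: connect_sub sub _ _ (cG a b).
Qed.
End Rotation.

Section Maximiser.
Variables (R : realType) (n e : nat) (G : sgraph).
Hypothesis Gmax : maximises_spectral_radius R n e G.
Let l : R := spectral_radius R G.

Lemma G_gt0 : (0 < #|G|)%N.
Proof. by case: Gmax => -[_ [G0 _] _] _. Qed.

Lemma perron_positive : exists x : G -> R, (forall u, 0 < x u) /\
  forall u, adjsum x u = l * x u.
Proof.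
have [x [x0 [u0 xu0] xE]] := perron_vector R G_gt0.
exists x; split=> // u; rewrite lt_neqAle x0 andbT eq_sym; apply: contraTneq xu0 => xu.
(* Where x vanishes, its row is a zero sum of nonnegative terms, so x vanishes at all neighbours,
   and by connectivity at u0. *)
have cl : closed (@adj G) [pred a | x a == 0].
  have sym : connect_sym (@adj G) by apply: sym_connect_sym; exact: adj_sym.
  apply: (intro_closed sym) => a b ab; rewrite !inE => /eqP xa.
  have := xE a; rewrite xa mulr0 => /eqP.
  rewrite psumr_eq0 => [/allP/(_ b)|c _]; last by rewrite mulr_ge0.
  by rewrite mem_index_enum ab mul1r; apply.
have [[_ [_ cG] _] _] := Gmax.
have := closed_connect cl (cG u u0); rewrite !inE xu eqxx => /esym/eqP ->.
by rewrite ltxx.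
Qed.

Variable x : G -> R.
Hypotheses (x0 : forall u, 0 < x u) (xE : forall u, adjsum x u = l * x u).

(** The rotation changes the quadratic form by 2 x_w (x_u - x_v). If x_u >= x_v, maximality of G
    puts the new graph in the equality case, so x is also its eigenvector for l; but its row at u
    has gained x_w > 0. *)
Lemma rotation_lt (v w u : G) : adj v w -> ~~ adj u w -> u != w ->
  connected_graph (rotation v w u) -> x u < x v.
Proof.
move=> vw nuw uw cH; rewrite ltNge; apply/negP => hx.
have [[Gn cG eG] mG] := Gmax.
have H_in : in_C n e (rotation v w u) by split=> //; rewrite rot_edges.
have hl := mG _ H_in; rewrite -/l in hl.
have hr : l * \sum_u x u ^+ 2 <= \sum_(a : rotation v w u) x a * adjsum (G := rotation v w u) x a.
  have -> : \sum_(a : rotation v w u) x a * adjsum (G := rotation v w u) x a =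
      \sum_a \sum_b (rot_rel v w u a b)%:R * (x a * x b).
    apply: eq_bigr => a _; rewrite /adjsum mulr_sumr.
    by apply: eq_bigr => b _; rewrite mulrCA.
  rewrite rot_form //.
  have -> : \sum_a \sum_b (adj a b)%:R * (x a * x b) = l * \sum_u x u ^+ 2.
    rewrite mulr_sumr; apply: eq_bigr => a _.
    rewrite expr2 mulrCA -xE /adjsum mulr_sumr.
    by apply: eq_bigr => b _; rewrite mulrCA.
  by rewrite lerDl mulr_ge0 // mulr_ge0 ?subr_ge0 // ltW.
have hu := rayleigh_eq (G := rotation v w u) G_gt0 hl hr u.
have : l * x u = l * x u + x w.
  by rewrite -{1}hu -xE; exact: (rot_row_u vw nuw uw x).
by rewrite -[X in X = _]addr0 => /addrI /esym/eqP; rewrite gt_eqF.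
Qed.

(** If a vertex z of largest entry missed some vertex, connectivity would give an edge a b with z
    adjacent to a but not to b. Rotating it to z b keeps the graph connected through a z b. *)
Lemma top_dominates : exists z : G, forall u, u != z -> adj z u.
Proof.
have /card_gt0P[u0 _] := G_gt0.
pose z := [arg max_(i > u0) x i]%O.
have zmax u : x u <= x z.
  by rewrite /z; case: Order.TotalTheory.arg_maxP => // i _ /(_ u isT).
exists z => u uz; apply/negPn/negP => nzu.
have [[_ [_ cG] _] _] := Gmax.
have sym : connect_sym (@adj G) by apply: sym_connect_sym; exact: adj_sym.
have ncl : ~ closed (@adj G) [pred a | (a == z) || adj z a].
  move=> cl; have := closed_connect cl (cG z u).
  by rewrite !inE eqxx (negPf uz) (negPf nzu).
apply: ncl; apply: (intro_closed sym) => a b ab; rewrite !inE => ha.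
apply/negPn/negP; rewrite negb_or => /andP[bz nzb].
have za : adj z a.
  by case/orP: ha => // /eqP E; move: nzb; rewrite -E ab.
have az : a != z by apply: contraTneq za => ->; rewrite adj_irr.
have zb : z != b by rewrite eq_sym.
have cR : connected_graph (rotation a b z).
  have [[_ cG' _] _] := Gmax; apply: (@rot_connected _ _ _ _ z) => //.
    by rewrite /rot_rel adj_sym za /same_pair eqxx [z == a]eq_sym (negPf zb) (negPf az) /= andbF.
  by rewrite /rot_rel /same_pair !eqxx zb orbT.
by have := rotation_lt ab nzb zb cR; rewrite ltNge zmax.
Qed.

Lemma neighbours_nested (z a b c : G) : (forall u, u != z -> adj z u) ->
  b != z -> a != c -> adj b c -> x b <= x a -> adj a c.
Proof.
move=> hz bz ac bc xab; apply/negPn/negP => nac.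
have az : a != z.
  by apply: contraNneq nac => E; rewrite E hz // -E eq_sym.
have cz : c != z by apply: contraNneq nac => ->; rewrite adj_sym hz.
have cR : connected_graph (rotation b c a).
  have [[_ cG' _] _] := Gmax; apply: (@rot_connected _ _ _ _ z) => //.
    rewrite /rot_rel adj_sym hz // /same_pair eqxx ![z == _]eq_sym (negPf cz) (negPf bz).
    by rewrite /= andbF.
  by rewrite /rot_rel hz // /same_pair ![z == _]eq_sym (negPf bz) (negPf cz).
by have := rotation_lt bc nac ac cR; rewrite ltNge xab.
Qed.
End Maximiser.

Lemma strict_of_fun (f : nat -> nat) N : (forall i, f i.+1 <= (f i).-1)%N -> f N = 0%N ->
  exists2 p, strict p & forall i, nth 0%N p i = f i.
Proof.
elim: N f => [|N IH] f hf fN.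
  exists [::] => // i; rewrite nth_nil; elim: i => // i IHi.
  by move: (hf i); rewrite -IHi leqn0 => /eqP.
have [p st pE] := IH (fun i => f i.+1) (fun i => hf i.+1) fN.
case f0: (f 0%N) => [|m].
  exists [::] => // i; rewrite nth_nil; elim: i => // i IHi.
  by move: (hf i); rewrite -IHi leqn0 => /eqP.
exists (f 0%N :: p); last by case.
by rewrite /= st andbT -nth0 pE f0 (leq_ltn_trans (hf 0%N)) // f0.
Qed.

(** * The threshold order on a maximiser *)

Section Ranking.
Variables (R : realType) (n e : nat) (G : sgraph).
Hypothesis Gmax : maximises_spectral_radius R n e G.
Hypothesis n2 : (1 < n)%N.
Let l : R := spectral_radius R G.

Lemma maximiser_ranking : exists (x : G -> R) q (r : G -> nat), [/\ forall u, 0 < x u,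
  forall u, adjsum x u = l * x u, strict (n.-1 :: q) & ranking (n.-1 :: q) r].
Proof.
have Gn : #|G| = n by case: Gmax => -[].
have n0 : (0 < n)%N by exact: ltnW.
have [x [x0 xE]] := perron_positive Gmax.
have [z hz] := top_dominates Gmax x0 xE.
pose ge (a b : G) := x b <= x a.
(* [z] is put in front by hand, since a tie could let the sort place another vertex before it. *)
pose s' := sort ge (rem z (enum G)).
pose s := z :: s'.
have us : uniq s.
  by rewrite /= mem_sort sort_uniq mem_rem_uniqF ?enum_uniq // rem_uniq ?enum_uniq.
have ms a : a \in s.
  by rewrite inE mem_sort mem_rem_uniq ?enum_uniq // !inE mem_enum andbT; case: eqP.
have ss : size s = n.
  rewrite -Gn cardE; apply/perm_size/uniq_perm => //; first exact: enum_uniq.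
  by move=> a; rewrite ms mem_enum.
pose v i := nth z s i.
have vK u : v (index u s) = u by exact: nth_index.
have iK i : (i < n)%N -> index (v i) s = i by move=> h; rewrite index_uniq ?ss.
have v_inj i j : (i < n)%N -> (j < n)%N -> v i = v j -> i = j.
  by move=> hi hj /(congr1 (index^~ s)); rewrite !iK.
have mono i j : (0 < i)%N -> (i < j)%N -> (j < n)%N -> x (v j) <= x (v i).
  case: i j => [|i] [|j] // _ ij jn.
  have ge_total : total ge by move=> a b; exact: le_total.
  have ge_trans : transitive ge by move=> b a c h1 h2; exact: le_trans h2 h1.
  have ss' : size s' = n.-1 by rewrite -ss.
  apply: (sorted_ltn_nth ge_trans z (sort_sorted ge_total _)) => //; rewrite inE -/s' ss'; lia.
have nested i j c : (i < j)%N -> (j < n)%N -> (c < n)%N -> c != i ->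
    adj (v j) (v c) -> adj (v i) (v c).
  move=> ij jn cn ci jc; have i_n : (i < n)%N by exact: ltn_trans jn.
  have neq : v i != v c by apply: contra ci => /eqP/(v_inj _ _ i_n cn) ->.
  case: (posnP i) => [i0|ip]; first by rewrite i0; apply: hz; rewrite eq_sym -[z]/(v 0%N) -i0.
  apply: (neighbours_nested Gmax x0 xE hz) jc (mono _ _ ip ij jn) => //.
  by apply/eqP => /(v_inj _ 0%N jn n0) E; rewrite E in ij.
pose P i (j : 'I_n) := (i < j)%N && adj (v i) (v j).
(* The distance to the farthest later neighbour. By nestedness every vertex in between is a
   neighbour too, so these distances are the parts. *)
pose c i := if (i < n)%N then (\max_(j < n | P i j) (j - i))%N else 0%N.
have c_ge i j : (i < j)%N -> (j < n)%N -> adj (v i) (v j) -> (j - i <= c i)%N.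
  move=> ij jn h; rewrite /c (ltn_trans ij jn).
  by apply: (@leq_bigmax_cond _ (P i) (fun j : 'I_n => j - i)%N (Ordinal jn)); rewrite /P ij.
have c_att i : (0 < c i)%N -> exists2 j, (i < j < n)%N && adj (v i) (v j) & c i = (j - i)%N.
  rewrite /c; case: ifP => // i_n cp.
  have Pp : (0 < #|P i|)%N.
    rewrite lt0n; apply/eqP => /card0_eq Pi0.
    have Pi j : P i j = false by have := Pi0 j; rewrite unfold_in.
    by move: cp; rewrite big_pred0.
  have [j Pj ->] := eq_bigmax_cond (fun j : 'I_n => j - i)%N Pp.
  by exists j => //; move: Pj; rewrite unfold_in /P ltn_ord andbT.
have adjE i j : (i < j)%N -> (j < n)%N -> adj (v i) (v j) = (j <= i + c i)%N.
  move=> ij jn; apply/idP/idP => [h|h]; first by have := c_ge i j ij jn h; lia.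
  have [|j' /andP[/andP[ij' jn'] h'] cE] := c_att i; first lia.
  have [->//|jj'] := eqVneq j j'.
  have lt_jj' : (j < j')%N by move: jj'; rewrite neq_ltn => /orP[//|]; lia.
  rewrite adj_sym; apply: nested lt_jj' jn' (ltn_trans ij jn) _ _; first by rewrite ltn_eqF.
  by rewrite adj_sym.
(* The farthest later neighbour of [v i.+1] is also a neighbour of [v i], one step further away. *)
have c_step i : (c i.+1 <= (c i).-1)%N.
  case: (posnP (c i.+1)) => [->//|/c_att[j /andP[/andP[ij jn] h] cE]].
  have := c_ge i j (ltnW ij) jn (nested i i.+1 j (leqnn _) (ltn_trans ij jn) jn _ h).
  have ji : j != i by rewrite neq_ltn (ltnW ij) orbT.
  by move=> /(_ ji); lia.
have cn0 : c n = 0%N by rewrite /c ltnn.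
have [p st pE] := strict_of_fun c_step cn0.
have c0 : c 0%N = n.-1.
  apply/eqP; rewrite eqn_leq; apply/andP; split.
    rewrite /c (ltn_trans _ n2) //; apply/bigmax_leqP => j _; rewrite subn0.
    by have := ltn_ord j; lia.
  have h1 : (0 < n.-1)%N by lia.
  have h2 : (n.-1 < n)%N by lia.
  rewrite -[X in (X <= _)%N]subn0; apply: c_ge => //; apply: hz.
  by apply/eqP => /(v_inj _ 0%N h2 n0) E; rewrite E in h1.
case: p st pE => [|d q] st pE.
  by have := pE 0%N; rewrite c0 /=; lia.
have dE : d = n.-1 by rewrite -c0 -pE.
subst d; exists x, q, (fun u => index u s); split=> //; split.
- by move=> a b /(congr1 v); rewrite !vK.
- by move=> u; rewrite Gn -ss index_mem.
move=> a b; rewrite -{1}[a]vK -{1}[b]vK.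
have [an bn] : (index a s < n)%N /\ (index b s < n)%N by rewrite -ss !index_mem.
move: (index a s) (index b s) an bn => i j i_n jn.
have [ij|ji|->] := ltngtP i j; last by rewrite padjxx adj_irr.
  by rewrite adjE // /padj ltn_eqF //= (maxn_idPr (ltnW ij)) (minn_idPl (ltnW ij)) pE.
rewrite adj_sym padj_sym adjE //.
by rewrite /padj ltn_eqF //= (maxn_idPr (ltnW ji)) (minn_idPl (ltnW ji)) pE.
Qed.

Lemma maximiser_partition : 0 < l -> exists q (r : G -> nat),
  [/\ strict (n.-1 :: q), ranking (n.-1 :: q) r, sumn q = e, good l q
    & l * l = n.-1%:R + psi l q].
Proof.
move=> l0; have [x [q [r [x0 xE st rk]]]] := maximiser_ranking.
have [[Gn [G0 _] eG] _] := Gmax.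
have GN : #|G| = (n.-1 + 0).+1 by rewrite addn0 Gn prednK // ltnW.
have sE : sumn q = e.
  have ft : fits #|G| (n.-1 :: q) by rewrite /fits Gn prednK // ltnW.
  by move: eG; rewrite (edges_ranking st ft rk) /=; lia.
pose X i := if [pick u | r u == i] is Some u then x u else 1.
have Xr u : X (r u) = x u.
  rewrite /X; case: pickP => [w /eqP|/(_ u)]; last by rewrite eqxx.
  by have [ir _ _] := rk => /ir ->.
have rowE i : (i < #|G|)%N -> 0 < X i /\
    l * X i = \sum_(0 <= j < (n.-1 + 0).+1) (padj (n.-1 :: q) i j)%:R * X j.
  move=> /(ranking_ex rk)[u <-]; rewrite Xr; split=> //.
  rewrite -xE -GN -(adjsum_ranking X u rk).
  by apply: eq_bigr => w _; rewrite /= Xr.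
have sq : strict q by case/andP: st.
have [X0 r0] := rowE 0%N G0; rewrite row_cons // in r0.
have sX : solves l (X 0%N) n.-1 q (fun i => X i.+1).
  move=> i i_n; have [|Xi ri] := rowE i.+1; first by rewrite GN addn0.
  by split=> //; rewrite ri row_cons // i_n.
have [gq E] := solves_psi l0 sq (fits_tail st) X0 sX.
exists q, r; split=> //.
apply: (mulIf (lt0r_neq0 X0)); rewrite -mulrA r0 E mulrC.
by [].
Qed.
End Ranking.

(** * The graphs D and V *)

Lemma complete1_adj (i j : 'I_1) : complete_rel i j = false.
Proof. by rewrite /complete_rel !ord1 eqxx. Qed.

Lemma complete_adj m (i j : 'I_m) : complete_rel i j = ((i : nat) != j).
Proof. by []. Qed.

Lemma padj_Dlist n k t i j : (t < k)%N -> (k < n)%N -> (i < n)%N -> (j < n)%N ->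
  padj (n.-1 :: Dlist k t) i j = (i != j) && [|| minn i j == 0%N,
    (minn i j <= t)%N && (maxn i j <= k.+1)%N | (maxn i j <= k)%N].
Proof.
move=> tk kn i_n jn; rewrite /padj; case: (eqVneq i j) => //= ij.
have lt_mM : (minn i j < maxn i j)%N by lia.
have lt_Mn : (maxn i j < n)%N by lia.
move: (minn i j) (maxn i j) lt_mM lt_Mn => a b ab bn.
case: a ab => [|a] ab /=; first by lia.
rewrite /Dlist; have [ak|ak] := ltnP a k.-1.
  rewrite nth_mkseq //; case: leqP => ta /=; apply/idP/idP; lia.
by rewrite nth_default ?size_mkseq //; apply/idP/idP; lia.
Qed.

Lemma D_ranking n e k t : k_ e = k -> t_ e = t -> (t < k)%N -> (k < n)%N ->
  (t != 0 -> k + 1 < n)%N ->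
  #|D_graph n e| = n /\ exists r : D_graph n e -> nat, ranking (n.-1 :: Dlist k t) r.
Proof.
move=> ke te tk kn hn; rewrite /D_graph ke te; case: leqP => h.
  set D := gjoin _ _.
  have cD : #|D| = n.
    by rewrite /D /= !card_sum !card_ord; lia.
  split=> //.
  (* Order by degree: the final cone vertex, the t vertices joined to the extra vertex, the rest of
     the clique, the extra vertex k + 1, then the vertices of degree one. *)
  pose r (v : D) : nat := match v with
    | inr _ => 0
    | inl (inl (inr i)) => i.+1
    | inl (inl (inl (inl i))) => (t + i).+1
    | inl (inl (inl (inr _))) => k.+1
    | inl (inr i) => (k.+2 + i)
    end%N.
  have rn v : (r v < n)%N.
    by case: v => [[[[i|i]|i]|i]|i] /=; have := ltn_ord i; lia.
  exists r; split; last 1 first.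
  - move=> u v; rewrite padj_Dlist //.
    case: u => [[[[i|i]|i]|i]|i]; case: v => [[[[j|j]|j]|j]|j] /=;
      rewrite ?complete1_adj ?complete_adj ?/(edgeless_rel _ _);
      have := ltn_ord i; have := ltn_ord j; lia.
  - case=> [[[[i|i]|i]|i]|i]; case=> [[[[j|j]|j]|j]|j] //= E;
      have := ltn_ord i; have := ltn_ord j; try lia => _ _.
    + by have -> : i = j by apply: val_inj => /=; lia.
    + by have -> : i = j by rewrite !ord1.
    + by have -> : i = j by apply: val_inj => /=; lia.
    + by have -> : i = j by apply: val_inj => /=; lia.
    + by have -> : i = j by rewrite !ord1.
  - by move=> u; rewrite cD.
(* Here n = k + 1, and the graph is complete. *)
have t0 : t = 0%N by case: (t) hn => // m /(_ isT); lia.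
split; first by rewrite /= card_ord.
exists val; split; first exact: val_inj.
  by move=> u; rewrite /= card_ord.
move=> u v; rewrite padj_Dlist ?ltn_ord // -[LHS]/(\val u != \val v).
have : (\val u < n)%N := ltn_ord u; have : (\val v < n)%N := ltn_ord v; lia.
Qed.

Lemma padj_star n e i j : (e.+1 < n)%N -> (i < n)%N -> (j < n)%N ->
  padj [:: n.-1; e] i j = (i != j) && ((minn i j == 0%N) || (minn i j == 1%N) && (maxn i j <= e.+1)%N).
Proof.
move=> en i_n jn; rewrite /padj; case: (eqVneq i j) => //= ij.
have lt_mM : (minn i j < maxn i j)%N by lia.
have lt_Mn : (maxn i j < n)%N by lia.
move: (minn i j) (maxn i j) lt_mM lt_Mn => a b ab bn.
by case: a ab => [|[|a]] ab /=; rewrite ?nth_nil; lia.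
Qed.

Lemma V_ranking n e : (e.+1 < n)%N ->
  #|V_graph n e| = n /\ exists r : V_graph n e -> nat, ranking [:: n.-1; e] r.
Proof.
move=> en; set V := V_graph n e.
have cV : #|V| = n.
  by rewrite /V /= !card_sum !card_ord; lia.
split=> //.
pose r (v : V) : nat := match v with
  | inr _ => 0
  | inl (inl (inl _)) => 1
  | inl (inl (inr i)) => i.+2
  | inl (inr i) => (e.+2 + i)
  end%N.
have rn v : (r v < n)%N.
  by case: v => [[[i|i]|i]|i] /=; have := ltn_ord i; lia.
exists r; split; last 1 first.
- move=> u v; rewrite padj_star //.
  case: u => [[[i|i]|i]|i]; case: v => [[[j|j]|j]|j] /=;
    rewrite ?complete1_adj ?/(edgeless_rel _ _);
    have := ltn_ord i; have := ltn_ord j; lia.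
- case=> [[[i|i]|i]|i]; case=> [[[j|j]|j]|j] //= E;
    have := ltn_ord i; have := ltn_ord j; try lia => _ _.
  + by have -> : i = j by rewrite !ord1.
  + by have -> : i = j by apply: val_inj => /=; lia.
  + by have -> : i = j by apply: val_inj => /=; lia.
  + by have -> : i = j by rewrite !ord1.
- by move=> u; rewrite cV.
Qed.

Lemma mul_pred_half k : ((k * k.-1)./2 * 2 = k * k.-1)%N.
Proof.
rewrite muln2 halfK; have -> : odd (k * k.-1) = false; last by rewrite subn0.
by case: k => //= k; rewrite oddM /=; case: odd.
Qed.

Lemma k_t_eq e k : (0 < k)%N -> (k * k.-1 <= 2 * e < k.+1 * k)%N ->
  k_ e = k /\ t_ e = (e - (k * k.-1)./2)%N.
Proof.
move=> k0 /andP[h1 h2]; have [c1 c2] := k_P e.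
have ke : k_ e = k.
  apply/eqP; rewrite eqn_leq; apply/andP; split; last first.
    by apply: c2; rewrite bin2; move: h1; lia.
  rewrite leqNgt; apply/negP => hk.
  have := leq_trans (leq_bin2l 2 hk) c1; have := mul_pred_half k.+1.
  by rewrite bin2; lia.
by rewrite /t_ ke bin2.
Qed.

Theorem proposition1p10 (R : realType) (e n : nat) (G : sgraph) :
  (4 <= e <= 130)%N -> (b_ e <= n)%N ->
  maximises_spectral_radius R n e G ->
  giso G (D_graph n e) \/ ((e + 2 <= n)%N /\ giso G (V_graph n e)).
Proof.
move=> he hb Gmax.
have e0 : (0 < e)%N by case/andP: he => /(leq_trans _) ->.
case: (partition_dichotomy R he); cbv zeta; move: (clique_size e) => k hk.
have k3 : (2 < k)%N by nia.
have [ke te] := k_t_eq (ltn_trans (isT : (0 < 2)%N) k3) hk; rewrite -te.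
set D := Dlist k (t_ e) => stD sD dich.
have dbl := mul_pred_half k.
have tk : (t_ e < k)%N by rewrite te; nia.
have kn : (k < n)%N.
  by apply: leq_trans hb; rewrite /b_ ke; case: ifP; rewrite ?addn1 ?addn2.
have hn : (t_ e != 0 -> k + 1 < n)%N.
  by move=> t0; apply: leq_trans hb; rewrite /b_ ke (negPf t0) addn1 addn2.
have [Gn _] := Gmax; have {Gn} [Gn [G0 _] _] := Gn.
have n0 : (0 < n)%N by exact: leq_ltn_trans kn.
have [cD [rD rkD]] := D_ranking ke erefl tk kn hn.
have stnD : strict (n.-1 :: D).
  rewrite /= stD andbT /D /Dlist -nth0 nth_mkseq; last by lia.
  by move: hn; case: (t_ e) => [|m] /= hn; lia.
have D_in : in_C n e (D_graph n e) by apply: in_C_ranking rkD sD.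
set l := spectral_radius R G.
have lD : spectral_radius R (D_graph n e) <= l by case: Gmax => _; apply.
(* Vertices 0, .., k of the ranked [D_graph] form a clique, which brings l into the range of the
   dichotomy. *)
have kl : k%:R <= l.
  apply: le_trans lD; apply: (radius_clique R rkD); first by rewrite cD.
  move=> i j ij jk; rewrite padj_Dlist //; lia.
have l0 : 0 < l by rewrite (lt_le_trans _ kl) // ltr0n; lia.
have n1 : (1 < n)%N by lia.
have [q [r [stq rkq sq gq lE]]] := maximiser_partition Gmax n1 l0.
have stq' : strict q by case/andP: stq.
have isoV : q = [:: e] -> giso G (D_graph n e) \/ ((e + 2 <= n)%N /\ giso G (V_graph n e)).
  move=> qE; subst q; right; have en : (e.+1 < n)%N by move: stq => /= /andP[]; lia.
  split; first by rewrite addn2.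
  have [cV [rV rkV]] := V_ranking en.
  by apply: giso_of_ranking rkq rkV; rewrite cV.
have [/isoV //|qe] := eqVneq q [:: e].
case: (dich l kl) => [[gD dom]|[el hel dom]].
  have [qD|qD] := eqVneq q D.
    by left; subst q; apply: giso_of_ranking rkq rkD; rewrite cD.
  have lt := dom q stq' gq sq qD qe.
  suff : l < l by rewrite ltxx.
  apply: lt_le_trans lD; apply: (radius_gt cD n0 l0 stnD rkD gD).
  by rewrite lE ltrD2l.
have lt := dom q stq' gq sq qe.
have [en|en] := ltnP e.+1 n.
  have [cV [rV rkV]] := V_ranking en.
  have stV : strict [:: n.-1; e] by rewrite /= !andbT -ltnS prednK // en.
  have V_in : in_C n e (V_graph n e) by apply: (in_C_ranking cV n0 stV rkV); rewrite /= addn0.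
  have lV : spectral_radius R (V_graph n e) <= l by case: Gmax => _; apply.
  suff : l < l by rewrite ltxx.
  apply: lt_le_trans lV; apply: (radius_gt cV n0 l0 stV rkV).
    by rewrite /= andbT addr0; lra.
  by rewrite lE ltrD2l.
(* Now n - 1 <= e gives [psi l q] >= l^2 - e, while star dominance and [hel] give the opposite
   strict inequality. *)
exfalso; move: lt; rewrite psi1; last by rewrite gt_eqF // subr_gt0.
have ne : n.-1%:R <= e%:R :> R by rewrite ler_nat -ltnS prednK.
rewrite ltr_pdivlMr ?subr_gt0 // => lt.
have := ler_wpM2r (_ : 0 <= l * l - e%:R) (_ : l * l - e%:R <= psi l q).
have h1 : 0 <= l * l - e%:R by lra.
have h2 : l * l - e%:R <= psi l q by rewrite lE; lra.
by move=> /(_ h1 h2); lra.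
Qed.
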